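(* Let $G$ be a connected graph of order $n$ with diameter $d\ge 2$, and suppose $G$ is not isomorphic to the path $P_{d+1}$. Then $m_G[n-d+2,n]\le n-d$, with equality if and only if (i) $G\cong G_{n,d,t}$ for some integer $t$ with $2\le t\le \lfloor d/2\rfloor+1$, or (ii) $G\cong G_{n,d,r,a}$ for some integers $r,a$ with $2\le r\le \lfloor (d+1)/2\rfloor$ and $1\le a\le n-d-2$.
   Context: All graphs are finite and simple. The Laplacian matrix of a graph $G$ is $L(G)=D(G)-A(G)$ (degree diagonal matrix minus adjacency matrix); its eigenvalues, the Laplacian eigenvalues, are denoted $\mu_1(G)\ge\mu_2(G)\ge\dots\ge\mu_n(G)$ and all lie in $[0,n]$. For an interval $I\subseteq[0,n]$, $m_G I$ denotes the number of Laplacian eigenvalues of $G$ (counted with multiplicity) lying in $I$. The diameter is the largest distance between two vertices. $P_k$ is the path on $k$ vertices and $K_k$ the complete graph on $k$ vertices. For integers $2\le d\le n-2$ and $2\le t\le d$, $G_{n,d,t}$ is the graph obtained from a path $v_1v_2\dots v_{d+1}$ and a vertex-disjoint complete graph $K_{n-d-1}$ by adding all edges between every vertex of $K_{n-d-1}$ and each of $v_{t-1},v_t,v_{t+1}$. For integers $3\le d\le n-2$, $2\le r\le d-1$ and $1\le a\le n-d-2$, $G_{n,d,r,a}$ is the graph obtained from a path $v_1v_2\dots v_{d+1}$ and a vertex-disjoint complete graph $K_{n-d-1}$ by adding all edges between every vertex of $K_{n-d-1}$ and each of $v_r,v_{r+1}$, all edges between $v_{r-1}$ and a fixed set of $a$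 vertices of $K_{n-d-1}$, and all edges between $v_{r+2}$ and each of the remaining $n-d-1-a$ vertices of $K_{n-d-1}$. *)

(* Defs.v *)
(* Graphs are symmetric irreflexive relations on 'I_n;
   Laplacian eigenvalues are taken in algC (the algebraic complex numbers),
   where the characteristic polynomial of the (integer) Laplacian splits. *)
From HB Require Import structures.
From mathcomp Require Import all_boot all_order all_algebra all_field.
Set Implicit Arguments. Unset Strict Implicit. Unset Printing Implicit Defensive.
Import Order.TTheory GRing.Theory Num.Theory.

Definition vdeg (n : nat) (g : rel 'I_n) (x : 'I_n) : nat := #|[pred y | g x y]|.

Definition laplacian (n : nat) (g : rel 'I_n) : 'M[algC]_n :=
  \matrix_(i, j) (if i == j then (vdeg g i)%:R else - (g i j)%:R)%R.

(* Laplacian eigenvalues with multiplicity: a sequence r with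
   char_poly L = lead_coef * prod_(z <- r) (X - z); since char_poly is monic
   this is the full list of roots with multiplicity. *)
Definition lap_eigs (n : nat) (g : rel 'I_n) : seq algC :=
  sval (closed_field_poly_normal (char_poly (laplacian g))).

Definition lap_count_cc (n : nat) (g : rel 'I_n) (a b : algC) : nat :=
  count (fun z => (a <= z) && (z <= b))%R (lap_eigs g).

Definition connected_graph (n : nat) (g : rel 'I_n) : Prop :=
  forall x y, connect g x y.

Definition within (n : nat) (g : rel 'I_n) (k : nat) (x y : 'I_n) : Prop :=
  exists p : seq 'I_n, [/\ path g x p, last x p = y & size p <= k].

Definition diameter (n : nat) (g : rel 'I_n) (d : nat) : Prop :=
  (forall x y, within g d x y) /\
  (d = 0 \/ exists x y, ~ within g d.-1 x y).

Definition graph_iso (T U : finType) (g : rel T) (h : rel U) : Prop :=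
  exists f : T -> U, bijective f /\ forall x y, g x y = h (f x) (f y).

Definition path_graph (k : nat) : rel 'I_k :=
  fun x y => ((val x).+1 == val y) || ((val y).+1 == val x).

(* G_{n,d,t}: vertices 0..d form the path v_1..v_{d+1} (index i is v_{i+1}),
   vertices d+1..n-1 form K_{n-d-1}, each joined to v_{t-1}, v_t, v_{t+1}. *)
Definition G_ndt (n d t : nat) : rel 'I_n := fun x y =>
  let i := val x in let j := val y in
  if (i <= d) && (j <= d) then (i.+1 == j) || (j.+1 == i)
  else if (d < i) && (d < j) then i != j
  else let p := minn i j in (t - 2 <= p) && (p <= t).

(* G_{n,d,r,a}: same path and clique; every clique vertex is joined to
   v_r, v_{r+1}; the clique vertices d+1..d+a (a fixed set of a vertices)
   are joined to v_{r-1}; the remaining clique vertices are joined to v_{r+2}. *)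
Definition G_ndra (n d r a : nat) : rel 'I_n := fun x y =>
  let i := val x in let j := val y in
  if (i <= d) && (j <= d) then (i.+1 == j) || (j.+1 == i)
  else if (d < i) && (d < j) then i != j
  else let p := minn i j in let c := maxn i j in
    [|| p.+1 == r, p.+1 == r.+1,
        (p.+1 == r.-1) && (c < d.+1 + a)
      | (p.+1 == r.+2) && (d.+1 + a <= c)].

Arguments path_graph k : clear implicits.
Arguments G_ndt n d t : clear implicits.
Arguments G_ndra n d r a : clear implicits.

(* Main.v *)
(* Write k = n - d - 1 for the number of vertices off a diametral path
   v_0 ... v_d, so that the threshold n - d + 2 is k + 3. Eigenvalues are counted
   by Courant-Fischer: if the Laplacian form Q(x), the sum of |x_i - x_j|^2 over
   the edges, stays below (k + 3)|x|^2 for all nonzero x in a subspace of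
   codimension m, then at most m eigenvalues reach k + 3; dually for lower
   bounds. On the path, 4 sum |y_a|^2 - sum |y_a - y_{a+1}|^2 equals
   2|y_0|^2 + 2|y_d|^2 + sum |y_a + y_{a+1}|^2, a positive definite form, and each
   vertex where x vanishes contributes at most |x|^2 to Q. A vertex off the path
   has its path neighbours in a window of three consecutive path vertices, so
   putting x = 0 off the path and at the centre of one window gives the bound
   k + 1. If some off-path vertex misses a vertex of its window, or two of them
   are nonadjacent or have windows at distance at least 2, a subspace of
   codimension k already works; hence in the case of equality the off-path
   vertices form a clique with at most two, consecutive, windows, which are the
   graphs G_{n,d,t} and G_{n,d,r,a} up to reversing the path. Conversely these
   graphs contain K_{k+3} minus an edge, respectively K_{k+2} with every vertex
   having one more neighbour, which provides a subspace of dimension k + 1 on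
   which Q(x) >= (k + 3)|x|^2. *)
Require Import Defs.
From HB Require Import structures.
From mathcomp Require Import all_boot all_order all_algebra all_field.
From mathcomp Require Import perm zify ring.
Import Order.TTheory GRing.Theory Num.Theory.

Set Implicit Arguments.
Unset Strict Implicit.
Unset Printing Implicit Defensive.

Local Open Scope ring_scope.
Local Open Scope sesquilinear_scope.

(** * Courant-Fischer counting for the Laplacian *)

(** The matrix [C] of all constraints has rank at most [size cs], so its left kernel is nonzero. *)
Lemma exists_row_orthogonal (F : fieldType) (n : nat) (cs : seq 'cV[F]_n) :
  (size cs < n)%N ->
  exists2 u : 'rV[F]_n, u != 0 & forall c, c \in cs -> u *m c = 0.
Proof.
move=> lt_cs_n; pose C := \matrix_(i < n, j < size cs) (cs`_j) i 0.
have : kermx C != 0.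
  rewrite -mxrank_eq0 mxrank_ker -lt0n subn_gt0.
  exact: leq_ltn_trans (rank_leq_col C) lt_cs_n.
case/rowV0Pn=> u /sub_kermxP uC0 u_neq0; exists u => // c /(nthP 0)[j lt_j <-].
apply/matrixP=> i k; rewrite !ord1 [RHS]mxE.
transitivity ((u *m C) 0 (Ordinal lt_j)); last by rewrite uC0 mxE.
by rewrite !mxE; apply: eq_bigr => l _; rewrite !mxE.
Qed.

Definition normsq (n : nat) (x : 'I_n -> algC) : algC := \sum_i `|x i| ^+ 2.

(* Sums over ordered pairs, hence twice the Laplacian quadratic form. *)
Definition lapform (n : nat) (g : rel 'I_n) (x : 'I_n -> algC) : algC :=
  \sum_i \sum_j (g i j)%:R * `|x i - x j| ^+ 2.

Lemma normsq_ge0 n (x : 'I_n -> algC) : 0 <= normsq x.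
Proof. by apply: sumr_ge0 => i _; apply: exprn_ge0. Qed.

(** Expanding the squares, the cross terms factor into the squared modulus of the sum. This is the
    Laplacian form of a complete graph: it bounds every eigenvalue by [n], and it is exact on
    cliques when the entries sum to zero. *)
Lemma sum_dist_sq (I : finType) (S : {pred I}) (x : I -> algC) :
  \sum_(i in S) \sum_(j in S) `|x i - x j| ^+ 2 =
  2%:R * (#|S|%:R * \sum_(i in S) `|x i| ^+ 2)
    - 2%:R * `|\sum_(i in S) x i| ^+ 2.
Proof.
rewrite [in RHS]normCK rmorph_sum /=.
transitivity (\sum_(i in S) \sum_(j in S) (`|x i| ^+ 2 + `|x j| ^+ 2
    - (x i * (x j)^* + x j * (x i)^*))).
  apply: eq_bigr => i _; apply: eq_bigr => j _.
  by rewrite !normCK rmorphB /=; ring.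
under [LHS]eq_bigr do rewrite sumrB !big_split /=.
rewrite sumrB !big_split /=.
have -> : \sum_(i in S) \sum_(j in S) x j * (x i)^*
    = \sum_(i in S) \sum_(j in S) x i * (x j)^* by rewrite exchange_big.
have -> : \sum_(i in S) \sum_(j in S) x i * (x j)^*
    = (\sum_(i in S) x i) * (\sum_(i in S) (x i)^*).
  by rewrite mulr_suml; apply: eq_bigr => i _; rewrite mulr_sumr.
have -> : \sum_(i in S) \sum_(j in S) `|x i| ^+ 2
    = #|S|%:R * \sum_(i in S) `|x i| ^+ 2.
  under eq_bigr do rewrite sumr_const.
  by rewrite sumrMnl mulr_natl.
by rewrite sumr_const -mulr_natl; ring.
Qed.

Section Spectrum.

Variables (n : nat) (g : rel 'I_n).
Hypothesis gsym : symmetric g.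
Hypothesis girr : irreflexive g.

Let L := laplacian g.
Let P := spectralmx L.
Let sp := spectral_diag L.

Lemma laplacian_hermitian : L \is hermsymmx.
Proof.
apply: realsym_hermsym.
  apply/is_hermitianmxP; rewrite expr0 scale1r; apply/matrixP=> i j.
  rewrite !mxE /= eq_sym; case: eqP => [->|_] //; by rewrite gsym.
apply/mxOverP=> i j; rewrite mxE; case: ifP => _; first exact: realn.
by rewrite rpredN realn.
Qed.

Lemma laplacian_spectral : L = invmx P *m diag_mx sp *m P.
Proof. exact/orthomx_spectralP/hermitian_normalmx/laplacian_hermitian. Qed.

Lemma spectral_real i : sp 0 i \is Num.real.
Proof. by have /mxOverP := hermitian_spectral_diag_real laplacian_hermitian. Qed.

(** The diagonalisation is carried to polynomial matrices, where the scalar matrix ['X%:M] commutes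
    with everything, so the conjugating factors cancel in the determinant. *)
Lemma char_poly_laplacian : char_poly L = \prod_i ('X - (sp 0 i)%:P).
Proof.
have Pu : P \in unitmx by apply: spectral_unit.
have -> : char_poly L = char_poly (diag_mx sp).
  rewrite /char_poly /char_poly_mx {1}laplacian_spectral.
  pose Pp := map_mx (@polyC _) P; pose Pi := map_mx (@polyC _) (invmx P).
  have PiP : Pi *m Pp = 1%:M by rewrite -map_mxM mulVmx // map_mx1.
  have -> : 'X%:M - map_mx polyC (invmx P *m diag_mx sp *m P)
     = Pi *m ('X%:M - map_mx polyC (diag_mx sp)) *m Pp.
    rewrite mulmxBr mulmxBl !map_mxM; congr (_ - _).
    by rewrite scalar_mxC -mulmxA PiP mulmx1.
  rewrite !det_mulmx mulrAC -det_mulmx PiP det1 mul1r //.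
rewrite char_poly_trig; first by apply: eq_bigr => i _; rewrite mxE eqxx.
by apply/is_trig_mxP=> i j ij; rewrite mxE; case: eqP ij => // ->; rewrite ltnn.
Qed.

Lemma count_lap_eigs (p : pred algC) :
  count p (lap_eigs g) = #|[pred i | p (sp 0 i)]|.
Proof.
have perm_sp : perm_eq (lap_eigs g) [seq sp 0 i | i <- enum 'I_n].
  apply: prod_XsubC_eq; rewrite big_map big_enum -char_poly_laplacian.
  rewrite /lap_eigs; case: closed_field_poly_normal => r /= def_char; rewrite def_char.
  by rewrite (monicP (char_poly_monic _)) scale1r.
rewrite (seq.permP perm_sp) count_map cardE size_filter.
by rewrite /enum_mem count_filter; apply: eq_count => i; rewrite !inE andbT.
Qed.

Lemma normsq_mulmx (u : 'rV[algC]_n) : normsq (u 0) = (u *m u^t*) 0 0.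
Proof. by rewrite mxE; apply: eq_bigr => i _; rewrite !mxE normCK. Qed.

Lemma normsq_spectral (a : 'rV[algC]_n) : normsq ((a *m P) 0) = normsq (a 0).
Proof.
have Pu : P \is unitarymx by apply: spectral_unitarymx.
rewrite !normsq_mulmx trmx_mul map_mxM mulmxA -(mulmxA a).
by rewrite (unitarymxP Pu) mulmx1.
Qed.

Lemma lapform_mulmx (u : 'rV[algC]_n) :
  lapform g (u 0) = 2%:R * (u *m L *m u^t*) 0 0.
Proof.
have -> : (u *m L *m u^t*) 0 0 =
   \sum_i \sum_j (g i j)%:R * (u 0 i * (u 0 i)^* - u 0 j * (u 0 i)^*).
  rewrite mxE; apply: eq_bigr => i _; rewrite !mxE.
  under [RHS]eq_bigr do rewrite mulrBr.
  rewrite sumrB -mulr_suml.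
  have -> : \sum_j (g i j)%:R = (vdeg g i)%:R :> algC.
    rewrite -natr_sum; congr _%:R.
    rewrite /vdeg -sum1_card [RHS]big_mkcond /=; by apply: eq_bigr => j _; rewrite inE; case: (g i j).
  rewrite (bigD1 i) //= mxE eqxx mulrDl mulr_suml [u 0 i * _]mulrC -mulrA.
  congr (_ + _); rewrite [in RHS](bigD1 i) //= girr mul0r add0r -sumrN.
  apply: eq_bigr => j /negPf ji; rewrite mxE ji [in LHS]gsym.
  by rewrite mulrN mulNr mulrCA mulrA.
rewrite /lapform mulr_sumr.
have -> : \sum_i \sum_j (g i j)%:R * `|u 0 i - u 0 j| ^+ 2
   = \sum_i \sum_j (g i j)%:R * (u 0 i * (u 0 i)^* - u 0 j * (u 0 i)^*)
   + \sum_i \sum_j (g i j)%:R * (u 0 j * (u 0 j)^* - u 0 i * (u 0 j)^*).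
  rewrite -big_split; apply: eq_bigr => i _ /=.
  rewrite -big_split; apply: eq_bigr => j _ /=.
  by rewrite normCK rmorphB /=; ring.
rewrite [X in _ + X]exchange_big /= -big_split; apply: eq_bigr => i _ /=.
rewrite mulrDl mul1r; congr (_ + _); apply: eq_bigr => j _; by rewrite gsym.
Qed.

Lemma lapform_spectral (a : 'rV[algC]_n) :
  lapform g ((a *m P) 0) = 2%:R * \sum_i sp 0 i * `|a 0 i| ^+ 2.
Proof.
have Pu : P \is unitarymx by apply: spectral_unitarymx.
rewrite lapform_mulmx laplacian_spectral; congr (_ * _).
rewrite trmx_mul map_mxM !mulmxA mulmxK ?unitarymx_unit //.
rewrite -(mulmxA (a *m _) P) (unitarymxP Pu) mulmx1.
rewrite mxE; apply: eq_bigr => i _; rewrite !mxE (bigD1 i) //= big1 ?addr0.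
  by rewrite !mxE eqxx mulr1n normCK mulrA [a 0 i * _]mulrC.
by move=> j /negPf ji; rewrite mxE ji mulr0n mulr0.
Qed.

(** Dimension count in the eigenbasis: vanishing of the coordinates outside [A] together with the
    constraints [cs] makes fewer than [n] linear conditions. *)
Lemma spectral_test_vector (A : pred 'I_n) (cs : seq 'cV[algC]_n) :
  (size cs < #|A|)%N ->
  exists a : 'rV[algC]_n, [/\ a != 0, forall i, ~~ A i -> a 0 i = 0
    & forall c, c \in cs -> a *m P *m c = 0].
Proof.
move=> lt_cs.
have := @exists_row_orthogonal _ n
  ([seq P *m c | c <- cs] ++ [seq delta_mx i 0 | i <- enum [predC A]]).
case.
  rewrite size_cat !size_map -cardE -[X in (_ < X)%N]card_ord -(cardC A).
  by rewrite ltn_add2r.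
move=> a a0 aC; exists a; split=> // [i Ai|c ccs].
  have /aC : delta_mx i 0 \in [seq P *m c | c <- cs] ++
      [seq delta_mx i 0 | i <- enum [predC A]].
    rewrite mem_cat; apply/orP; right; apply/mapP; exists i => //.
    by rewrite mem_enum.
  by rewrite -colE => /matrixP/(_ 0 0); rewrite !mxE.
by rewrite -mulmxA; apply: aC; rewrite mem_cat map_f.
Qed.

(** With more than [size cs] eigenvalues in the interval, some nonzero combination of their
    eigenvectors satisfies every constraint, and on it the form is at least [c] times the squared
    norm. The factor 2 matches the ordered pairs in [lapform]. *)
Lemma lap_count_le (c b : algC) (cs : seq 'cV[algC]_n) :
  (forall u : 'rV[algC]_n, (forall l, l \in cs -> u *m l = 0) ->
     2%:R * (c * normsq (u 0)) <= lapform g (u 0) -> u = 0) ->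
  (lap_count_cc g c b <= size cs)%N.
Proof.
move=> cs_neg; rewrite /lap_count_cc count_lap_eigs leqNgt.
apply/negP=> /spectral_test_vector[a [a0 supp_a aP]].
have /eqP : a *m P = 0.
  apply: cs_neg => //.
  rewrite normsq_spectral lapform_spectral ler_pM2l ?ltr0n // mulr_sumr.
  apply: ler_sum => i _; have [/andP[ci _]|/supp_a->] :=
    boolP ([pred i | c <= sp 0 i <= b] i).
    by rewrite ler_wpM2r ?exprn_ge0.
  by rewrite normr0 expr0n !mulr0.
move/eqP=> aP0; move: a0.
by rewrite -[a](mulmxK (spectral_unit L)) aP0 mul0mx eqxx.
Qed.

Lemma lapform_le (x : 'I_n -> algC) :
  lapform g x <= 2%:R * (n%:R * normsq x).
Proof.
apply: (@le_trans _ _ (\sum_i \sum_j `|x i - x j| ^+ 2)).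
  apply: ler_sum => i _; apply: ler_sum => j _.
  by case: (g i j); rewrite ?mul1r // mul0r exprn_ge0.
by rewrite sum_dist_sq card_ord lerBlDr lerDl mulr_ge0 ?exprn_ge0 ?ler0n.
Qed.

(** The right end [n] of the interval is thus no restriction: an eigenvalue outside it must lie
    below the left end. The bound comes from testing [lapform_le] on a single eigenvector. *)
Lemma spectral_le_order i : sp 0 i <= n%:R.
Proof.
pose a : 'rV[algC]_n := delta_mx 0 i.
have aE j : `|a 0 j| ^+ 2 = (j == i)%:R.
  by rewrite mxE eqxx; case: eqP; rewrite ?normr1 ?expr1n ?normr0 ?expr0n.
have norm_a : normsq (a 0) = 1.
  rewrite /normsq (bigD1 i) //= big1 => [|j /negPf ji]; rewrite aE ?eqxx ?ji //.
  by rewrite addr0.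
have form_a : \sum_j sp 0 j * `|a 0 j| ^+ 2 = sp 0 i.
  rewrite (bigD1 i) //= big1 => [|j /negPf ji]; rewrite aE ?eqxx ?ji ?mulr0 //.
  by rewrite mulr1 addr0.
have := lapform_le ((a *m P) 0).
by rewrite normsq_spectral lapform_spectral norm_a form_a mulr1 ler_pM2l ?ltr0n.
Qed.

(** Dual count: too few eigenvalues in the interval would leave a nonzero admissible vector spanned
    by eigenvectors with eigenvalue below [c]. Since [algC] is only partially ordered, [c] is
    assumed real so that the comparison can be negated. *)
Lemma lap_count_ge (c : algC) (cs : seq 'cV[algC]_n) :
  c \is Num.real ->
  (forall u : 'rV[algC]_n, (forall l, l \in cs -> u *m l = 0) ->
     2%:R * (c * normsq (u 0)) <= lapform g (u 0)) ->
  (n - size cs <= lap_count_cc g c n%:R)%N.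
Proof.
move=> c_real cs_pos; rewrite /lap_count_cc count_lap_eigs leqNgt.
apply/negP => lt_cs; pose A := [pred i | c <= sp 0 i <= n%:R].
have /spectral_test_vector[a [a0 supp_a aP]] : (size cs < #|[predC A]|)%N.
  rewrite -(ltn_add2l #|A|) cardC card_ord.
  by move: (lt_cs : (#|A| < n - size cs)%N); lia.
have := cs_pos _ aP; rewrite normsq_spectral lapform_spectral.
rewrite ler_pM2l ?ltr0n // -subr_ge0 mulr_sumr -sumrB => ge0.
(* Each term is nonpositive and is zero only where the coordinate vanishes, so a nonnegative total
   forces all coordinates to vanish. *)
have term_le i : sp 0 i * `|a 0 i| ^+ 2 - c * `|a 0 i| ^+ 2 <= 0
    ?= iff (a 0 i == 0).
  rewrite -mulrBl; have [Ai|/supp_a->] := boolP ([predC A] i); last first.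
    by rewrite normr0 expr0n mulr0 eqxx; apply/leif_refl.
  have lt_c : sp 0 i - c < 0.
    rewrite subr_lt0 real_ltNge ?spectral_real //.
    by have : ~~ (c <= sp 0 i <= n%:R) := Ai; rewrite spectral_le_order andbT.
  split; first by rewrite mulr_le0_ge0 ?exprn_ge0 // ltW.
  by rewrite mulf_eq0 (lt_eqF lt_c) /= expf_eq0 normr_eq0.
have := leif_sum (P := predT) (fun i _ => term_le i).
rewrite sumr_const mul0rn => -[le0 eq0].
have /esym := eq0; rewrite eq_le le0 ge0 /= => /forallP a_eq0.
by case/eqP: a0; apply/rowP=> i; rewrite mxE; apply/eqP/a_eq0.
Qed.

End Spectrum.

(** * Energy of a path *)

Section PathEnergy.

Local Notation sq z := (`|z : algC| ^+ 2).

Lemma sq_ge0 (z : algC) : 0 <= sq z.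
Proof. exact: exprn_ge0. Qed.

Lemma sq_eq0 (z : algC) : sq z = 0 -> z = 0.
Proof. by move/eqP; rewrite expf_eq0 normr_eq0 => /eqP. Qed.

Lemma double_sq_eq0 (z : algC) : 2%:R * sq z = 0 -> z = 0.
Proof. by move/eqP; rewrite mulf_eq0 pnatr_eq0 => /eqP/sq_eq0. Qed.

Lemma addr_le0_eq0 (a b : algC) :
  0 <= a -> 0 <= b -> a + b <= 0 -> a = 0 /\ b = 0.
Proof.
move=> a0 b0 ab; have /eqP : a + b = 0 by apply/le_anti; rewrite ab addr_ge0.
by rewrite paddr_eq0 // => /andP[/eqP-> /eqP->].
Qed.

Variables (d : nat) (y : nat -> algC).

(** The part of the positive definite path form lying outside the edges between [lo] and [hi]. *)
Definition tails (lo hi : nat) : algC :=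
  2%:R * sq (y 0) + \sum_(0 <= a < lo) sq (y a + y a.+1)
  + (2%:R * sq (y d) + \sum_(hi <= a < d) sq (y a + y a.+1)).

Lemma tails_ge0 lo hi : 0 <= tails lo hi.
Proof.
by rewrite !addr_ge0 ?mulr_ge0 ?sq_ge0 ?sumr_ge0 ?ler0n // => *; apply: sq_ge0.
Qed.

Lemma sum_sq_eq0 lo hi : \sum_(lo <= a < hi) sq (y a + y a.+1) = 0 ->
  forall a, (lo <= a < hi)%N -> y a = - y a.+1.
Proof.
move/eqP; rewrite psumr_eq0 => [/allP all0 a a_in|*]; last exact: sq_ge0.
apply/eqP; rewrite -addr_eq0; apply/eqP/sq_eq0/eqP.
by apply: (all0 a); rewrite mem_index_iota.
Qed.

(** The end entries vanish, and [y a = - y a.+1] carries the zero inwards from both ends. *)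
Lemma tails_eq0 lo hi : (hi <= d)%N -> tails lo hi = 0 ->
  (forall a, (a <= lo)%N -> y a = 0) /\
  (forall a, (hi <= a <= d)%N -> y a = 0).
Proof.
move=> hid /eqP; rewrite paddr_eq0; last 2 first.
- by rewrite addr_ge0 ?mulr_ge0 ?sq_ge0 ?sumr_ge0 ?ler0n // => *; apply: sq_ge0.
- by rewrite addr_ge0 ?mulr_ge0 ?sq_ge0 ?sumr_ge0 ?ler0n // => *; apply: sq_ge0.
rewrite !paddr_eq0 ?mulr_ge0 ?sq_ge0 ?sumr_ge0 ?ler0n //; last 2 first.
- by move=> *; apply: sq_ge0.
- by move=> *; apply: sq_ge0.
case/andP=> /andP[/eqP/double_sq_eq0 y0 /eqP/sum_sq_eq0 lo0].
case/andP=> /eqP/double_sq_eq0 yd /eqP/sum_sq_eq0 hi0; split.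
  elim=> [//|a IH] alo; apply/eqP; rewrite -oppr_eq0 -lo0 ?alo //.
  by rewrite IH // ltnW.
move=> a /andP[hia ad]; rewrite -(subKn ad).
have : (d - a <= d - hi)%N by lia.
elim: (d - a)%N => [|b IH] bhi; first by rewrite subn0.
rewrite hi0; last by lia.
have -> : ((d - b.+1).+1 = d - b)%N by lia.
by rewrite IH ?oppr0 //; lia.
Qed.

(** By the parallelogram law on each edge, the squares of differences and of sums together count
    every inner entry four times and each end twice; the end terms make up the difference. The
    points [lo] and [hi] only choose where the sum is cut. *)
Lemma path_energy lo hi : (lo <= hi <= d)%N ->
  4%:R * (\sum_(0 <= a < d.+1) sq (y a))
    - \sum_(0 <= a < d) sq (y a - y a.+1)
  = tails lo hi + \sum_(lo <= a < hi) sq (y a + y a.+1).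
Proof.
case/andP=> lohi hid.
transitivity (2%:R * sq (y 0) + 2%:R * sq (y d)
   + \sum_(0 <= a < d) sq (y a + y a.+1)); last first.
  rewrite (big_cat_nat (n := hi)) //= (big_cat_nat (n := lo) (p := hi)) //=.
  by rewrite /tails; ring.
clear; elim: d => [|m IH]; first by rewrite !big_nat1 !big_geq //; ring.
rewrite !(big_nat_recr m.+1) // !(big_nat_recr m) //=.
have := IH; rewrite (big_nat_recr m) //=.
set A := \sum_(_ <= _ < _) _; set B := \sum_(_ <= _ < _) _.
set C := \sum_(_ <= _ < _) _ => IH'.
transitivity (4%:R * (A + sq (y m)) - B
  + (4%:R * sq (y m.+1) - sq (y m - y m.+1))); first by ring.
rewrite IH' !normCK; ring.
Qed.

Lemma big_nat_sub_le (F : nat -> algC) m lo hi : (forall a, 0 <= F a) ->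
  (lo <= hi <= m)%N -> \sum_(lo <= a < hi) F a <= \sum_(0 <= a < m) F a.
Proof.
move=> F0 /andP[lohi him].
rewrite (big_cat_nat (m := 0) (n := hi)) //=.
rewrite (big_cat_nat (m := 0) (n := lo) (p := hi)) //=.
rewrite -addrA addrCA lerDl addr_ge0 // sumr_ge0 //.
Qed.

Lemma big_nat3 (F : nat -> algC) s m : (s.+2 < m)%N ->
  (forall a, (a < m)%N -> ~~ (s <= a <= s.+2)%N -> F a = 0) ->
  \sum_(0 <= a < m) F a = F s + F s.+1 + F s.+2.
Proof.
move=> sm F0.
have le1 : (s <= s.+3)%N by lia.
have -> : \sum_(0 <= a < m) F a = \sum_(0 <= a < s) F a
   + (\sum_(s <= a < s.+3) F a + \sum_(s.+3 <= a < m) F a).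
  by rewrite -!big_cat_nat //; lia.
have -> : \sum_(0 <= a < s) F a = 0.
  by rewrite big_nat; apply: big1 => a /andP[_ a_s]; apply: F0; lia.
have -> : \sum_(s.+3 <= a < m) F a = 0.
  by rewrite big_nat; apply: big1 => a /andP[sa am]; apply: F0 => //; lia.
rewrite add0r addr0 big_ltn; last by lia.
rewrite big_ltn; last by lia.
by rewrite big_nat1 addrA.
Qed.

(** [W] is the squared norm off the path and [r] the energy of the edges meeting it. Combining the
    hypothesis with [path_energy] gives [tails lo hi + core <= 0], where the surplus [e] is kept
    only on the entries from [lo] to [hi]. If [core] is nonnegative, both summands vanish. Each
    configuration below thus reduces to writing [core], which involves few variables, as a sum of
    squares. *)
Lemma core_energy (e : nat) lo hi (W r : algC) : (lo <= hi <= d)%N ->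
  (4 + e)%:R * (\sum_(0 <= a < d.+1) sq (y a) + W) <=
     \sum_(0 <= a < d) sq (y a - y a.+1) + r ->
  let core := e%:R * \sum_(lo <= a < hi.+1) sq (y a)
    + \sum_(lo <= a < hi) sq (y a + y a.+1) + (4 + e)%:R * W - r in
  0 <= core ->
  [/\ core = 0, forall a, (a <= lo)%N -> y a = 0
    & forall a, (hi <= a <= d)%N -> y a = 0].
Proof.
move=> lhd le_r core core_ge0; have /andP[lohi hid] := lhd.
have tails_core : tails lo hi + core <= 0.
  have := path_energy lhd.
  set S := \sum_(0 <= a < d.+1) _ in le_r *.
  set E := \sum_(0 <= a < d) _ in le_r * => path_eq.
  have le_S : e%:R * \sum_(lo <= a < hi.+1) sq (y a) <= e%:R * S.
    rewrite ler_wpM2l ?ler0n // big_nat_sub_le //; last by lia.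
    by move=> a; apply: sq_ge0.
  apply: (@le_trans _ _ ((4 + e)%:R * (S + W) - (E + r))).
    rewrite /core natrD; apply: le_trans (_ : _ <= tails lo hi + (e%:R * S
      + \sum_(lo <= a < hi) sq (y a + y a.+1) + (4%:R + e%:R) * W - r)) _.
      by rewrite lerD2l !lerD2r.
    have -> : tails lo hi + (e%:R * S
      + \sum_(lo <= a < hi) sq (y a + y a.+1) + (4%:R + e%:R) * W - r)
      = tails lo hi + \sum_(lo <= a < hi) sq (y a + y a.+1)
       + (e%:R * S + (4%:R + e%:R) * W - r) by ring.
    rewrite -path_eq le_eqVlt; apply/orP; left; apply/eqP; ring.
  by rewrite subr_le0.
have [t0 c0] := addr_le0_eq0 (tails_ge0 lo hi) core_ge0 tails_core.
by have [zlo zhi] := tails_eq0 hid t0.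
Qed.

Lemma big_nat2 (F : nat -> algC) s :
  \sum_(s <= a < s.+2) F a = F s + F s.+1.
Proof. by rewrite big_ltn // big_nat1. Qed.

Lemma big_nat3s (F : nat -> algC) s :
  \sum_(s <= a < s.+3) F a = F s + (F s.+1 + F s.+2).
Proof. by rewrite big_ltn ?big_nat2 //; lia. Qed.

Lemma big_nat4s (F : nat -> algC) s :
  \sum_(s <= a < s.+4) F a = F s + (F s.+1 + (F s.+2 + F s.+3)).
Proof. by rewrite big_ltn ?big_nat3s //; lia. Qed.

Lemma big_nat5s (F : nat -> algC) s :
  \sum_(s <= a < s.+4.+1) F a
  = F s + (F s.+1 + (F s.+2 + (F s.+3 + F s.+4))).
Proof. by rewrite big_ltn ?big_nat4s //; lia. Qed.

Lemma path_zero s : (s.+2 <= d)%N ->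
  (forall a, (a <= s)%N -> y a = 0) -> y s.+1 = 0 ->
  (forall a, (s.+2 <= a <= d)%N -> y a = 0) ->
  forall a, (a <= d)%N -> y a = 0.
Proof.
move=> sd lo0 mid0 hi0 a ad; case: (ltngtP a s.+1) => [|sa|->] //.
  by rewrite ltnS; apply: lo0.
by apply: hi0; rewrite sa.
Qed.

Local Notation S := (\sum_(0 <= a < d.+1) sq (y a)).
Local Notation E := (\sum_(0 <= a < d) sq (y a - y a.+1)).

(** With the window centre and [w] at zero, the two remaining edges at [w] cancel the two path terms
    of the window exactly, so [core] is identically zero. *)
Lemma one_vertex_zero s (w : algC) : (s.+2 <= d)%N ->
  4%:R * (S + sq w) <=
    E + (sq (w - y s) + sq (w - y s.+1) + sq (w - y s.+2)) ->
  y s.+1 = 0 -> w = 0 ->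
  forall a, (a <= d)%N -> y a = 0.
Proof.
move=> sd H mid0 w0; have lhd : (s <= s.+2 <= d)%N by lia.
have [|c0 lo0 hi0] := @core_energy 0 _ _ _ _ lhd H; last exact: (path_zero sd).
rewrite mul0r !big_nat2 mid0 w0.
suff -> : (0 + (sq (y s + 0) + sq (0 + y s.+2)) + (4 + 0)%:R * sq 0
  - (sq (0 - y s) + sq (0 - 0) + sq (0 - y s.+2))) = 0 by [].
by rewrite !normCK; ring.
Qed.

(** The vertex [w] misses the right end of its window. Identifying the other two entries turns
    [core] into a sum of two squares, one of them in [w + y s]. *)
Lemma two_left_zero s (w : algC) : (s.+2 <= d)%N ->
  4%:R * (S + sq w) <= E + (sq (w - y s) + sq (w - y s.+1)) ->
  y s = y s.+1 ->
  w = 0 /\ forall a, (a <= d)%N -> y a = 0.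
Proof.
move=> sd H eq_s; have lhd : (s <= s.+2 <= d)%N by lia.
have := @core_energy 0 _ _ _ _ lhd H.
rewrite /= !big_nat2 mul0r -eq_s.
have -> : (0 + (sq (y s + y s) + sq (y s + y s.+2)) + (4 + 0)%:R * sq w
  - (sq (w - y s) + sq (w - y s))) = sq (y s + y s.+2) + 2%:R * sq (w + y s).
  by rewrite !normCK; ring.
case=> [|c0 lo0 hi0]; first by rewrite addr_ge0 ?mulr_ge0 ?sq_ge0.
have ys0 : y s = 0 by apply: lo0.
move/eqP: c0; rewrite paddr_eq0 ?mulr_ge0 ?sq_ge0 // => /andP[_ /eqP].
rewrite ys0 addr0 => /double_sq_eq0 ->; split=> //.
by apply: (path_zero sd) => //; rewrite -eq_s.
Qed.

Lemma two_right_zero s (w : algC) : (s.+2 <= d)%N ->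
  4%:R * (S + sq w) <= E + (sq (w - y s.+1) + sq (w - y s.+2)) ->
  y s.+1 = y s.+2 ->
  w = 0 /\ forall a, (a <= d)%N -> y a = 0.
Proof.
move=> sd H eq_s; have lhd : (s <= s.+2 <= d)%N by lia.
have := @core_energy 0 _ _ _ _ lhd H.
rewrite /= !big_nat2 mul0r -eq_s.
set z := y s.+1.
have -> : (0 + (sq (y s + z) + sq (z + z)) + (4 + 0)%:R * sq w
  - (sq (w - z) + sq (w - z))) = sq (y s + z) + 2%:R * sq (w + z).
  by rewrite !normCK; ring.
case=> [|c0 lo0 hi0]; first by rewrite addr_ge0 ?mulr_ge0 ?sq_ge0.
have z0 : z = 0 by rewrite /z eq_s; apply: hi0; rewrite leqnn.
move/eqP: c0; rewrite paddr_eq0 ?mulr_ge0 ?sq_ge0 // => /andP[_ /eqP].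
rewrite z0 addr0 => /double_sq_eq0 ->; split=> //.
exact: (path_zero sd).
Qed.

(** The vertex [w] misses the centre of its window. With opposite end entries, [core] is twice the
    squared moduli of [w] and of the centre entry. *)
Lemma two_sides_zero s (w : algC) : (s.+2 <= d)%N ->
  4%:R * (S + sq w) <= E + (sq (w - y s) + sq (w - y s.+2)) ->
  y s.+2 = - y s ->
  w = 0 /\ forall a, (a <= d)%N -> y a = 0.
Proof.
move=> sd H eq_s; have lhd : (s <= s.+2 <= d)%N by lia.
have := @core_energy 0 _ _ _ _ lhd H.
rewrite /= !big_nat2 mul0r eq_s.
have -> : (0 + (sq (y s + y s.+1) + sq (y s.+1 - y s)) + (4 + 0)%:R * sq w
  - (sq (w - y s) + sq (w - - y s))) = 2%:R * sq (y s.+1) + 2%:R * sq w.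
  by rewrite !normCK; ring.
case=> [|c0 lo0 hi0]; first by rewrite addr_ge0 ?mulr_ge0 ?sq_ge0.
move/eqP: c0; rewrite paddr_eq0 ?mulr_ge0 ?sq_ge0 // => /andP[/eqP + /eqP].
move=> /double_sq_eq0 mid0 /double_sq_eq0 ->; split=> //.
exact: (path_zero sd).
Qed.

(** Two nonadjacent vertices with one common window. The constant is now 5, as two vertices off the
    path are left free; the surplus [e = 1] on the window makes [core] a sum of squares. *)
Lemma twins_zero s (w w' : algC) : (s.+2 <= d)%N ->
  5%:R * (S + (sq w + sq w')) <=
    E + (sq (w - y s) + sq (w - y s.+1) + sq (w - y s.+2)
      + (sq (w' - y s) + sq (w' - y s.+1) + sq (w' - y s.+2))) ->
  y s.+2 = - y s -> w = 0 ->
  w' = 0 /\ forall a, (a <= d)%N -> y a = 0.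
Proof.
move=> sd H eq_s w0; have lhd : (s <= s.+2 <= d)%N by lia.
have := @core_energy 1 _ _ _ _ lhd H.
rewrite /= big_nat2 big_nat3s eq_s w0.
set v := y s.+1; set a := y s.
have -> : (1 * (sq a + (sq v + sq (- a))) + (sq (a + v) + sq (v - a))
   + (4 + 1)%:R * (sq 0 + sq w') - (sq (0 - a) + sq (0 - v) + sq (0 - - a)
   + (sq (w' - a) + sq (w' - v) + sq (w' - - a)))) = sq (v + w') + sq w'.
  by rewrite !normCK; ring.
case=> [|c0 lo0 hi0]; first by rewrite addr_ge0 ?sq_ge0.
move/eqP: c0; rewrite paddr_eq0 ?sq_ge0 // => /andP[/eqP + /eqP].
move=> /sq_eq0 vw /sq_eq0 w'0; split=> //.
by apply: (path_zero sd) => //; rewrite -/v; move: vw; rewrite w'0 addr0.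
Qed.

(** Two nonadjacent vertices whose windows differ by one step. Zeros at the two shared path vertices
    decouple the sides, each giving its own sum of squares. *)
Lemma shifted_zero s (w w' : algC) : (s.+3 <= d)%N ->
  5%:R * (S + (sq w + sq w')) <=
    E + (sq (w - y s) + sq (w - y s.+1) + sq (w - y s.+2)
      + (sq (w' - y s.+1) + sq (w' - y s.+2) + sq (w' - y s.+3))) ->
  y s.+1 = 0 -> y s.+2 = 0 ->
  [/\ w = 0, w' = 0 & forall a, (a <= d)%N -> y a = 0].
Proof.
move=> sd H b0 c0; have lhd : (s <= s.+3 <= d)%N by lia.
have := @core_energy 1 _ _ _ _ lhd H.
rewrite /= big_nat3s big_nat4s b0 c0.
set a := y s; set e := y s.+3.
have -> : (1 * (sq a + (sq 0 + (sq 0 + sq e)))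
   + (sq (a + 0) + (sq (0 + 0) + sq (0 + e)))
   + (4 + 1)%:R * (sq w + sq w') - (sq (w - a) + sq (w - 0) + sq (w - 0)
   + (sq (w' - 0) + sq (w' - 0) + sq (w' - e))))
   = (sq (a + w) + sq w) + (sq (e + w') + sq w').
  by rewrite !normCK; ring.
case=> [|core0 lo0 hi0]; first by rewrite !addr_ge0 ?sq_ge0.
move/eqP: core0; rewrite !paddr_eq0 ?addr_ge0 ?sq_ge0 //.
case/andP=> /andP[_ /eqP/sq_eq0 w0] /andP[_ /eqP/sq_eq0 w'0]; split=> // i id.
case: (leqP i s) => [|si]; first exact: lo0.
case: (leqP s.+3 i) => [i3|]; first by apply: hi0; rewrite i3.
rewrite ltnS => i2; have : (i == s.+1) || (i == s.+2) by lia.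
by case/orP=> /eqP->.
Qed.

(** Windows sharing exactly one path vertex; the term in [w - w'] allows the two vertices to be
    adjacent. The last square in [core] is that of [y s.+3 + y s.+4 + w'], so [w'] vanishes once the
    path entries do. *)
Lemma overlap_zero s (w w' : algC) : (s.+4 <= d)%N ->
  5%:R * (S + (sq w + sq w')) <=
    E + (sq (w - y s) + sq (w - y s.+1) + sq (w - y s.+2)
      + (sq (w' - y s.+2) + sq (w' - y s.+3) + sq (w' - y s.+4))
      + sq (w - w')) ->
  y s.+2 = 0 -> w = 0 ->
  w' = 0 /\ forall a, (a <= d)%N -> y a = 0.
Proof.
move=> sd H m0 w0; have lhd : (s <= s.+4 <= d)%N by lia.
have := @core_energy 1 _ _ _ _ lhd H.
rewrite /= big_nat4s big_nat5s m0 w0.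
set a := y s; set b := y s.+1; set c := y s.+3; set e := y s.+4.
have -> : (1 * (sq a + (sq b + (sq 0 + (sq c + sq e))))
   + (sq (a + b) + (sq (b + 0) + (sq (0 + c) + sq (c + e))))
   + (4 + 1)%:R * (sq 0 + sq w') - (sq (0 - a) + sq (0 - b) + sq (0 - 0)
   + (sq (w' - 0) + sq (w' - c) + sq (w' - e)) + sq (0 - w')))
   = (sq (a + b) + sq b) + (sq c + sq (c + e + w')).
  by rewrite !normCK; ring.
case=> [|core0 lo0 hi0]; first by rewrite !addr_ge0 ?sq_ge0.
move/eqP: core0; rewrite !paddr_eq0 ?addr_ge0 ?sq_ge0 //.
case/andP=> /andP[_ /eqP/sq_eq0 b0] /andP[/eqP/sq_eq0 c0 /eqP/sq_eq0].
have -> : e = 0 by apply: hi0; lia.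
rewrite c0 !add0r => w'0; split=> // i id.
case: (leqP i s) => [|si]; first exact: lo0.
case: (leqP s.+4 i) => [i4|]; first by apply: hi0; rewrite i4.
rewrite !ltnS => i3; have : [|| i == s.+1, i == s.+2 | i == s.+3] by lia.
by case/or3P=> /eqP->.
Qed.

(** The extra edges cost at most one squared path norm, which lowers the constant from 5 to 4. With
    [lo = hi = 0] the whole path then belongs to the tail. *)
Lemma disjoint_zero (c : nat -> nat) : (forall a, (c a <= 1)%N) ->
  5%:R * S <= E + \sum_(0 <= a < d.+1) (c a)%:R * sq (y a) ->
  forall a, (a <= d)%N -> y a = 0.
Proof.
move=> c1 H.
have H' : (4 + 0)%:R * (S + 0) <= E + 0.
  rewrite !addr0 addn0 -(lerD2r S); apply: le_trans (le_trans H _); last first.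
    rewrite lerD2l; apply: ler_sum => a _.
    by rewrite ler_piMl ?sq_ge0 // lern1.
  by rewrite le_eqVlt; apply/orP; left; apply/eqP; ring.
have [|_ _ hi0] := @core_energy 0 0 0 _ _ (leq0n d) H'; last first.
  by move=> a ad; apply: hi0.
by rewrite !mul0r big_geq // !mulr0 !addr0 subr0.
Qed.

End PathEnergy.

(** * Counting eigenvalues with an induced path *)

Section Support.

Local Notation sq z := (`|z : algC| ^+ 2).

(** An edge leaving [R] costs only the squared modulus at its other end, and every vertex has at
    most [size R] such edges. Ordered pairs count each of them twice. *)
Lemma lapform_supp_le n (g : rel 'I_n) (x : 'I_n -> algC) (S R : seq 'I_n) :
  symmetric g -> perm_eq (index_enum 'I_n) (S ++ R) ->
  (forall z, z \in R -> x z = 0) ->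
  lapform g x <= \sum_(i <- S) \sum_(j <- S) (g i j)%:R * sq (x i - x j)
                 + 2%:R * ((size R)%:R * normsq x).
Proof.
move=> gsym SR xR0; rewrite /lapform (perm_big _ SR) big_cat /=.
have norm_S : normsq x = \sum_(i <- S) sq (x i).
  rewrite /normsq (perm_big _ SR) big_cat /= [X in _ + X]big_seq.
  by rewrite [X in _ + X]big1 ?addr0 // => i /xR0->; rewrite normr0 expr0n.
have cross : \sum_(i <- S) \sum_(j <- R) (g i j)%:R * sq (x i - x j)
    <= (size R)%:R * normsq x.
  rewrite norm_S mulr_sumr; apply: ler_sum => i _.
  have -> : (size R)%:R * sq (x i) = \sum_(j <- R) sq (x i).
    by rewrite mulr_natl big_const_seq count_predT iter_addr_0.
  rewrite big_seq [X in _ <= X]big_seq.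
  apply: ler_sum => j /xR0->; rewrite subr0.
  by case: (g i j); rewrite ?mul1r // mul0r sq_ge0.
have -> : \sum_(i <- S) \sum_j (g i j)%:R * sq (x i - x j)
  = \sum_(i <- S) \sum_(j <- S) (g i j)%:R * sq (x i - x j)
  + \sum_(i <- S) \sum_(j <- R) (g i j)%:R * sq (x i - x j).
  by rewrite -big_split; apply: eq_bigr => i _; rewrite (perm_big _ SR) big_cat.
have -> : \sum_(i <- R) \sum_j (g i j)%:R * sq (x i - x j)
  = \sum_(i <- S) \sum_(j <- R) (g i j)%:R * sq (x i - x j).
  rewrite exchange_big (perm_big _ SR) big_cat /= [X in _ + X]big1_seq.
    rewrite addr0; apply: eq_bigr => i _; apply: eq_bigr => j _.
    by rewrite gsym distrC.
  move=> i /andP[_ /xR0 xi0]; rewrite big1_seq // => j /andP[_ /xR0 xj0].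
  by rewrite xi0 xj0 subr0 normr0 expr0n mulr0.
by rewrite -addrA lerD2l mulrDl mul1r lerD.
Qed.

Lemma sum_adjacent (m : nat) (y : nat -> algC) :
  \sum_(0 <= a < m.+1) \sum_(0 <= b < m.+1)
     ((a.+1 == b) || (b.+1 == a))%:R * sq (y a - y b)
  = 2%:R * \sum_(0 <= a < m) sq (y a - y a.+1).
Proof.
elim: m => [|m IH]; first by rewrite !big_nat1 big_geq //= mul0r mulr0.
rewrite big_nat_recr //=.
under eq_bigr do rewrite big_nat_recr //=.
rewrite big_split /= IH [X in _ = 2%:R * X]big_nat_recr //=.
have last_sum (f : nat -> algC) :
    \sum_(0 <= a < m.+1) ((a.+1 == m.+1) || (m.+2 == a))%:R * f a = f m.
  rewrite big_nat_recr //= eqxx mul1r big_nat big1 ?add0r // => a /andP[_ am].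
  by rewrite (_ : _ || _ = false) ?mul0r //; lia.
rewrite last_sum big_nat_recr //=.
have -> : (m.+2 == m.+1) || (m.+2 == m.+1) = false by lia.
rewrite mul0r addr0.
under [X in _ + X]eq_bigr do rewrite orbC.
by rewrite last_sum (distrC (y m.+1)); ring.
Qed.

End Support.

Lemma mulmx_delta n (u : 'rV[algC]_n) z :
  (u *m (delta_mx z 0 : 'cV_n)) 0 0 = u 0 z.
Proof. by rewrite -colE mxE. Qed.

Lemma mulmx_deltaB n (u : 'rV[algC]_n) z z' :
  (u *m (delta_mx z 0 - delta_mx z' 0 : 'cV_n)) 0 0 = u 0 z - u 0 z'.
Proof. by rewrite mulmxBr mxE mulmx_delta mxE mulmx_delta. Qed.

Lemma mulmx_deltaD n (u : 'rV[algC]_n) z z' :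
  (u *m (delta_mx z 0 + delta_mx z' 0 : 'cV_n)) 0 0 = u 0 z + u 0 z'.
Proof. by rewrite mulmxDr mxE !mulmx_delta. Qed.

Section DiametralPath.

Local Notation sq z := (`|z : algC| ^+ 2).

Variables (n : nat) (g : rel 'I_n) (d : nat) (p : nat -> 'I_n).
Hypothesis gsym : symmetric g.
Hypothesis girr : irreflexive g.
Hypothesis p_adj : forall a b, (a <= d)%N -> (b <= d)%N ->
  g (p a) (p b) = (a.+1 == b) || (b.+1 == a).

Variable path_seq : seq 'I_n.
Hypothesis path_seqE : path_seq = [seq p a | a <- index_iota 0 d.+1].

(** The vertices of [R] absorb the summand [size R] of the constant, leaving an inequality with
    constant [c] on the path and [ws]. The factor one half turns ordered pairs inside [ws] back into
    edges. *)
Lemma lap_bound (x : 'I_n -> algC) (ws R : seq 'I_n) (c : nat) :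
  perm_eq (index_enum 'I_n) (path_seq ++ ws ++ R) ->
  (forall z, z \in R -> x z = 0) ->
  2%:R * ((size R + c)%:R * normsq x) <= lapform g x ->
  c%:R * (\sum_(0 <= a < d.+1) sq (x (p a)) + \sum_(w <- ws) sq (x w)) <=
    \sum_(0 <= a < d) sq (x (p a) - x (p a.+1)) +
    (\sum_(w <- ws) \sum_(0 <= a < d.+1) (g w (p a))%:R * sq (x w - x (p a))
     + 2%:R^-1 *
       \sum_(w <- ws) \sum_(w' <- ws) (g w w')%:R * sq (x w - x w')).
Proof.
rewrite catA => SR xR0 le_form.
have norm_S : normsq x =
    \sum_(0 <= a < d.+1) sq (x (p a)) + \sum_(w <- ws) sq (x w).
  rewrite /normsq (perm_big _ SR) big_cat /= [X in _ + X]big_seq.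
  rewrite [X in _ + X]big1 ?addr0; last first.
    by move=> i /xR0->; rewrite normr0 expr0n.
  by rewrite big_cat path_seqE big_map.
have := le_trans le_form (lapform_supp_le gsym SR xR0).
rewrite -norm_S => le_S; rewrite (natrD _ (size R) c) in le_S.
rewrite (mulrDl (size R)%:R) mulrDr addrC lerD2r in le_S.
rewrite -(ler_pM2l (ltr0n _ 2)) (le_trans le_S) // {le_S le_form norm_S}.
rewrite big_cat /= {1}path_seqE big_map.
have -> : \sum_(0 <= a < d.+1) \sum_(j <- path_seq ++ ws)
     (g (p a) j)%:R * sq (x (p a) - x j)
  = 2%:R * \sum_(0 <= a < d) sq (x (p a) - x (p a.+1)) +
    \sum_(w <- ws) \sum_(0 <= a < d.+1) (g w (p a))%:R * sq (x w - x (p a)).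
  under eq_bigr do rewrite big_cat /=.
  rewrite big_split /=; congr (_ + _).
    rewrite -(sum_adjacent _ (x \o p)); apply: eq_big_nat => a /andP[_ ad].
    rewrite path_seqE big_map; apply: eq_big_nat => b /andP[_ bd] /=.
    by rewrite p_adj.
  rewrite exchange_big /=; apply: eq_bigr => w _; apply: eq_bigr => a _.
  by rewrite gsym distrC.
have -> : \sum_(w <- ws) \sum_(j <- path_seq ++ ws) (g w j)%:R * sq (x w - x j)
  = \sum_(w <- ws) \sum_(0 <= a < d.+1) (g w (p a))%:R * sq (x w - x (p a))
  + \sum_(w <- ws) \sum_(w' <- ws) (g w w')%:R * sq (x w - x w').
  rewrite -big_split; apply: eq_bigr => w _.
  by rewrite big_cat path_seqE big_map.
rewrite !mulrDr mulVKf ?pnatr_eq0 //.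
rewrite le_eqVlt; apply/orP; left; apply/eqP; ring.
Qed.

(** Vanishing on [R] supplies [size R] constraints and [ex] the others. In the applications [c] is
    [size ws + 3], so that [size R + c] is the threshold. *)
Lemma count_by_constraints (ws R : seq 'I_n) (ex : seq 'cV[algC]_n)
    (c : nat) (b : algC) :
  perm_eq (index_enum 'I_n) (path_seq ++ ws ++ R) ->
  (forall u : 'rV[algC]_n, (forall l, l \in ex -> (u *m l) 0 0 = 0) ->
     c%:R * (\sum_(0 <= a < d.+1) sq (u 0 (p a)) + \sum_(w <- ws) sq (u 0 w)) <=
     \sum_(0 <= a < d) sq (u 0 (p a) - u 0 (p a.+1)) +
    (\sum_(w <- ws) \sum_(0 <= a < d.+1)
         (g w (p a))%:R * sq (u 0 w - u 0 (p a))
     + 2%:R^-1 *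
       \sum_(w <- ws) \sum_(w' <- ws) (g w w')%:R * sq (u 0 w - u 0 w')) ->
     (forall w, w \in ws -> u 0 w = 0)
     /\ (forall a, (a <= d)%N -> u 0 (p a) = 0)) ->
  (lap_count_cc g (size R + c)%:R b <= size R + size ex)%N.
Proof.
move=> SR ex_zero.
pose deltas : seq 'cV[algC]_n := [seq delta_mx z 0 | z <- R].
have <- : size (deltas ++ ex) = (size R + size ex)%N.
  by rewrite size_cat size_map.
apply: lap_count_le => // u u_cs le_form.
have uR0 z : z \in R -> u 0 z = 0.
  move=> zR; rewrite -mulmx_delta u_cs ?mxE // mem_cat; apply/orP; left.
  by apply/mapP; exists z.
have [l l_ex||ws0 p0] := ex_zero u.
- by rewrite u_cs ?mxE // mem_cat l_ex orbT.
- exact: lap_bound SR uR0 le_form.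
apply/rowP=> i; rewrite mxE; have := mem_index_enum i.
rewrite (perm_mem SR) !mem_cat => /or3P[|/ws0|/uR0] //.
rewrite path_seqE => /mapP[a + ->]; rewrite mem_index_iota => ad.
exact: p0.
Qed.

Definition in_window (w : 'I_n) (s : nat) : Prop :=
  (s.+2 <= d)%N /\
  forall a, (a <= d)%N -> g w (p a) -> (s <= a <= s.+2)%N.

Lemma window_sum w s (x : 'I_n -> algC) : in_window w s ->
  \sum_(0 <= a < d.+1) (g w (p a))%:R * sq (x w - x (p a)) =
  (g w (p s))%:R * sq (x w - x (p s))
  + (g w (p s.+1))%:R * sq (x w - x (p s.+1))
  + (g w (p s.+2))%:R * sq (x w - x (p s.+2)).
Proof.
case=> sd win.
rewrite (big_nat3 (s := s)) // => a; rewrite ltnS => ad a_out.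
case: (boolP (g w (p a))) => [/(win a ad) a_in|_]; last by rewrite mul0r.
by rewrite a_in in a_out.
Qed.

Lemma bool_mul_le (c : bool) (z : algC) : c%:R * sq z <= sq z.
Proof. by case: c; rewrite ?mul1r // mul0r sq_ge0. Qed.

Lemma outside_vertex_le w R s b :
  perm_eq (index_enum 'I_n) (path_seq ++ [:: w] ++ R) -> in_window w s ->
  (lap_count_cc g (size R + 4)%:R b <= size R + 2)%N.
Proof.
move=> SR win; have [sd _] := win.
apply: (@count_by_constraints [:: w] R
  [:: delta_mx w 0; delta_mx (p s.+1) 0] 4 b SR) => u u_ex.
have w0 : u 0 w = 0 by rewrite -mulmx_delta u_ex ?inE ?eqxx.
have m0 : u 0 (p s.+1) = 0 by rewrite -mulmx_delta u_ex ?inE ?eqxx ?orbT.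
rewrite !big_seq1 girr mul0r mulr0 addr0 (window_sum _ win) => le4.
split; first by move=> z; rewrite inE => /eqP->.
apply: (one_vertex_zero (y := u 0 \o p) sd (le_trans le4 _)) => //=.
by rewrite lerD2l !lerD ?bool_mul_le.
Qed.

(** A single relation between path entries, chosen according to the missing neighbour, replaces the
    two constraints of [outside_vertex_le] and saves one eigenvalue. *)
Lemma missing_neighbour_le w R s b :
  perm_eq (index_enum 'I_n) (path_seq ++ [:: w] ++ R) -> in_window w s ->
  ~~ [&& g w (p s), g w (p s.+1) & g w (p s.+2)] ->
  (lap_count_cc g (size R + 4)%:R b <= size R + 1)%N.
Proof.
move=> SR win; have [sd _] := win.
have split1 (u : 'rV[algC]_n) (A : Prop) : u 0 w = 0 /\ A ->
    (forall z, z \in [:: w] -> u 0 z = 0) /\ A.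
  by case=> w0 HA; split=> // z; rewrite inE => /eqP->.
rewrite !negb_and => /or3P[] /negPf missing.
- apply: (@count_by_constraints [:: w] R
    [:: delta_mx (p s.+1) 0 - delta_mx (p s.+2) 0] 4 b SR) => u u_ex.
  have eq_s : u 0 (p s.+1) = u 0 (p s.+2).
    have := u_ex _ (mem_head _ _).
    by rewrite mulmx_deltaB => /subr0_eq.
  rewrite !big_seq1 girr mul0r mulr0 addr0 (window_sum _ win) missing => le4.
  apply/split1/(two_right_zero (y := u 0 \o p) sd (le_trans le4 _)) => //=.
  by rewrite lerD2l mul0r add0r !lerD ?bool_mul_le.
- apply: (@count_by_constraints [:: w] R
    [:: delta_mx (p s) 0 + delta_mx (p s.+2) 0] 4 b SR) => u u_ex.
  have eq_s : u 0 (p s.+2) = - u 0 (p s).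
    have := u_ex _ (mem_head _ _).
    rewrite mulmx_deltaD => /eqP.
    by rewrite addrC addr_eq0 => /eqP.
  rewrite !big_seq1 girr mul0r mulr0 addr0 (window_sum _ win) missing => le4.
  apply/split1/(two_sides_zero (y := u 0 \o p) sd (le_trans le4 _)) => //=.
  by rewrite lerD2l mul0r addr0 !lerD ?bool_mul_le.
- apply: (@count_by_constraints [:: w] R
    [:: delta_mx (p s) 0 - delta_mx (p s.+1) 0] 4 b SR) => u u_ex.
  have eq_s : u 0 (p s) = u 0 (p s.+1).
    have := u_ex _ (mem_head _ _).
    by rewrite mulmx_deltaB => /subr0_eq.
  rewrite !big_seq1 girr mul0r mulr0 addr0 (window_sum _ win) missing => le4.
  apply/split1/(two_left_zero (y := u 0 \o p) sd (le_trans le4 _)) => //=.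
  by rewrite lerD2l mul0r addr0 !lerD ?bool_mul_le.
Qed.

(** With two free vertices, two constraints beyond those on [R] suffice in every configuration, one
    fewer than the general bound allows. *)
Lemma pair_le w w' R s s' b :
  perm_eq (index_enum 'I_n) (path_seq ++ [:: w; w'] ++ R) ->
  in_window w s -> in_window w' s' -> (s <= s')%N ->
  ~~ g w w' || (s.+2 <= s')%N ->
  (lap_count_cc g (size R + 5)%:R b <= size R + 2)%N.
Proof.
move=> SR win win' ss' pairH; have [[sd win_s] [s'd win_s']] := (win, win').
have split2 (u : 'rV[algC]_n) (A : Prop) : u 0 w = 0 -> u 0 w' = 0 /\ A ->
    (forall z, z \in [:: w; w'] -> u 0 z = 0) /\ A.
  by move=> w0 [w'0 HA]; split=> // z; rewrite !inE => /orP[]/eqP->.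
have two_ww' (u : 'rV[algC]_n) : 2%:R^-1 * \sum_(z <- [:: w; w'])
    \sum_(z' <- [:: w; w']) (g z z')%:R * sq (u 0 z - u 0 z')
    = (g w w')%:R * sq (u 0 w - u 0 w').
  rewrite !big_cons !big_nil !girr (gsym w' w) (distrC (u 0 w')).
  by rewrite !mul0r; field.
have two_sum (F : 'I_n -> algC) : \sum_(z <- [:: w; w']) F z = F w + F w'.
  by rewrite big_cons big_seq1.
(* As [s <= s'], the three cases are equal windows, windows at least two steps apart, and windows
   one step apart. *)
case: (ltngtP s'.+1 s.+2) => [s's|s's|s's].
- have es : s' = s by lia.
  subst s'; have /negPf nadj : ~~ g w w' by lia.
  apply: (@count_by_constraints [:: w; w'] R
    [:: delta_mx (p s) 0 + delta_mx (p s.+2) 0; delta_mx w 0] 5 b SR) => u u_ex.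
  have eq_s : u 0 (p s.+2) = - u 0 (p s).
    have := u_ex _ (mem_head _ _).
    rewrite mulmx_deltaD => /eqP.
    by rewrite addrC addr_eq0 => /eqP.
  have w0 : u 0 w = 0 by rewrite -mulmx_delta u_ex ?inE ?eqxx ?orbT.
  rewrite two_ww' !two_sum nadj mul0r addr0.
  rewrite (window_sum _ win) (window_sum _ win') => le5.
  apply: split2 => //.
  apply: (twins_zero (y := u 0 \o p) sd (le_trans le5 _)) eq_s w0.
  by rewrite lerD2l !lerD ?bool_mul_le.
- have [es|ne] := eqVneq s' s.+2.
    subst s'.
    apply: (@count_by_constraints [:: w; w'] R
      [:: delta_mx (p s.+2) 0; delta_mx w 0] 5 b SR) => u u_ex.
    have m0 : u 0 (p s.+2) = 0 by rewrite -mulmx_delta u_ex ?inE ?eqxx.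
    have w0 : u 0 w = 0 by rewrite -mulmx_delta u_ex ?inE ?eqxx ?orbT.
    rewrite two_ww' !two_sum (window_sum _ win) (window_sum _ win') => le5.
    apply: split2 => //.
    apply: (overlap_zero (y := u 0 \o p) s'd (le_trans le5 _)) m0 w0.
    by rewrite lerD2l !lerD ?bool_mul_le.
  apply: (@count_by_constraints [:: w; w'] R
    [:: delta_mx w 0; delta_mx w' 0] 5 b SR) => u u_ex.
  have w0 : u 0 w = 0 by rewrite -mulmx_delta u_ex ?inE ?eqxx.
  have w'0 : u 0 w' = 0 by rewrite -mulmx_delta u_ex ?inE ?eqxx ?orbT.
  rewrite two_ww' !two_sum w0 w'0 subr0 normr0 expr0n mulr0 !addr0 => le5.
  apply: split2 => //; split=> //.
  (* The windows are disjoint, so this function counts at most one neighbour of each path vertex. It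
     is cut off beyond [d], where nothing is known about [p]. *)
  apply: (@disjoint_zero d (u 0 \o p)
    (fun a => if (a <= d)%N then g w (p a) + g w' (p a) else 0)%N).
    move=> a; case: ifP => // ad.
    case: (boolP (g w (p a))) => [/(win_s a ad) a_in|_]; last by case: (g _ _).
    by case: (boolP (g w' (p a))) => // /(win_s' a ad); lia.
  apply: (le_trans le5); rewrite lerD2l -big_split /= !big_nat.
  apply: ler_sum => a /andP[_ ad]; rewrite ltnS in ad.
  by rewrite ad natrD mulrDl !sub0r normrN.
- have es : s' = s.+1 by lia.
  subst s'; have /negPf nadj : ~~ g w w' by lia.
  apply: (@count_by_constraints [:: w; w'] R
    [:: delta_mx (p s.+1) 0; delta_mx (p s.+2) 0] 5 b SR) => u u_ex.
  have b0 : u 0 (p s.+1) = 0 by rewrite -mulmx_delta u_ex ?inE ?eqxx.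
  have c0 : u 0 (p s.+2) = 0 by rewrite -mulmx_delta u_ex ?inE ?eqxx ?orbT.
  rewrite two_ww' !two_sum nadj mul0r addr0.
  rewrite (window_sum _ win) (window_sum _ win') => le5.
  have [|w0 w'0 p0] :=
    shifted_zero (y := u 0 \o p) s'd (le_trans le5 _) b0 c0; last exact: split2.
  by rewrite lerD2l !lerD ?bool_mul_le.
Qed.

End DiametralPath.

(** * Lower bounds for the count *)

Section LowerBound.

Local Notation sq z := (`|z : algC| ^+ 2).

Variables (n : nat) (h : rel 'I_n).
Hypothesis hsym : symmetric h.
Hypothesis hirr : irreflexive h.

(** Inside [S], nonadjacent vertices carry equal values, so the form is that of a complete graph and
    zero sum makes it exactly [#|S|] times the squared norm, up to the factor 2. The edges leaving
    [S] add at least [m] times the squared norm. *)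
Lemma lapform_ge (S : {set 'I_n}) (m : nat) (x : 'I_n -> algC) :
  (forall i, i \notin S -> x i = 0) -> \sum_i x i = 0 ->
  {in S &, forall i j, i != j -> h i j \/ x i = x j} ->
  {in S, forall i, m <= \sum_(j in ~: S) h i j}%N ->
  2%:R * ((#|S| + m)%:R * normsq x) <= lapform h x.
Proof.
move=> xS0 sum0 clique deg.
have sqS0 i : i \notin S -> sq (x i) = 0 by move/xS0->; rewrite normr0 expr0n.
have norm_S : normsq x = \sum_(i in S) sq (x i).
  by rewrite /normsq [LHS](bigID (mem S)) /= [X in _ + X]big1 ?addr0.
have splitS (F : 'I_n -> algC) :
    \sum_i F i = \sum_(i in S) F i + \sum_(i in ~: S) F i.
  rewrite (bigID (mem S)) /=; congr (_ + _).
  by apply: eq_bigl => i; rewrite inE.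
pose D i j : algC := (h i j)%:R * sq (x i - x j).
have cross : m%:R * normsq x <= \sum_(i in S) \sum_(j in ~: S) D i j.
  rewrite norm_S mulr_sumr; apply: ler_sum => i iS.
  have -> : \sum_(j in ~: S) D i j = (\sum_(j in ~: S) h i j)%N%:R * sq (x i).
    rewrite natr_sum mulr_suml; apply: eq_bigr => j; rewrite inE /D => /xS0->.
    by rewrite subr0.
  by rewrite ler_wpM2r ?sq_ge0 // ler_nat deg.
have cross' : \sum_(i in ~: S) \sum_(j in S) D i j
    = \sum_(i in S) \sum_(j in ~: S) D i j.
  rewrite exchange_big; apply: eq_bigr => i _; apply: eq_bigr => j _.
  by rewrite /D hsym distrC.
have inside : \sum_(i in S) \sum_(j in S) D i j = 2%:R * (#|S|%:R * normsq x).
  have -> : \sum_(i in S) \sum_(j in S) D i j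
      = \sum_(i in S) \sum_(j in S) sq (x i - x j).
    apply: eq_bigr => i iS; apply: eq_bigr => j jS; rewrite /D.
    have [->|/(clique i j iS jS)[->|->]] := eqVneq i j; rewrite ?mul1r //.
    - by rewrite subrr normr0 expr0n mulr0.
    - by rewrite subrr normr0 expr0n mulr0.
  rewrite sum_dist_sq -norm_S.
  have -> : \sum_(i in S) x i = 0.
    rewrite -[RHS]sum0 [RHS]splitS [X in _ = _ + X]big1 ?addr0 // => i.
    by rewrite inE => /xS0.
  by rewrite normr0 expr0n mulr0 subr0.
have outside : 0 <= \sum_(i in ~: S) \sum_(j in ~: S) D i j.
  by do 2![apply: sumr_ge0 => ? _]; rewrite mulr_ge0 ?sq_ge0 ?ler0n.
have -> : lapform h x = \sum_(i in S) \sum_(j in S) D i j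
   + \sum_(i in S) \sum_(j in ~: S) D i j
   + (\sum_(i in ~: S) \sum_(j in S) D i j
   + \sum_(i in ~: S) \sum_(j in ~: S) D i j).
  rewrite /lapform splitS -!big_split /=.
  by congr (_ + _); apply: eq_bigr => i _; rewrite splitS.
rewrite cross' inside (natrD _ #|S| m) (mulrDl #|S|%:R) mulrDr.
rewrite -addrA lerD2l addrA.
by rewrite [2%:R * _]mulrDl mul1r -[X in X <= _]addr0 !lerD.
Qed.

(** The constraints are zero entries on [L], zero sum, and [ex]. Only the members of [L] below [n]
    are vertices, so the true number of constraints is at most the one displayed. *)
Lemma lap_count_clique_ge (L : seq nat) (m : nat) (ex : seq 'cV[algC]_n)
    (S := [set i : 'I_n | val i \notin L]) :
  (forall u : 'rV[algC]_n, (forall l, l \in ex -> (u *m l) 0 0 = 0) ->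
    {in S &, forall i j, i != j -> h i j \/ u 0 i = u 0 j}) ->
  {in S, forall i, m <= \sum_(j in ~: S) h i j}%N ->
  (n - (size L + (size ex).+1) <=
     lap_count_cc h (n - size L + m)%:R n%:R)%N.
Proof.
move=> clique deg.
pose Z : seq 'I_n := pmap insub L.
have mem_Z i : (i \in Z) = (i \notin S).
  by rewrite inE negbK /Z mem_pmap_sub.
have size_Z : (size Z <= size L)%N by rewrite size_pmap_sub count_size.
pose cs := [seq delta_mx z 0 | z <- Z] ++ const_mx 1 :: ex.
apply: leq_trans (@lap_count_ge n h hsym hirr _ cs _ _); last 2 first.
- exact: realn.
- move=> u u_cs.
  have uZ0 i : i \notin S -> u 0 i = 0.
    rewrite -mem_Z => iZ; rewrite -mulmx_delta u_cs ?mxE // mem_cat.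
    by apply/orP; left; apply/mapP; exists i.
  have sum0 : \sum_i u 0 i = 0.
    have := u_cs (const_mx 1); rewrite mem_cat mem_head orbT => /(_ isT).
    move/matrixP/(_ 0 0); rewrite !mxE => {2}<-.
    by apply: eq_bigr => i _; rewrite mxE mulr1.
  apply: le_trans (lapform_ge uZ0 sum0 _ deg); last first.
    apply: clique => l l_ex; rewrite u_cs ?mxE // mem_cat inE l_ex.
    by rewrite !orbT.
  rewrite ler_pM2l ?ltr0n // ler_wpM2r ?normsq_ge0 // ler_nat leq_add2r.
  have := cardsC S; rewrite card_ord => cardS.
  have le_Z : (#|~: S| <= size Z)%N.
    apply: leq_trans (card_size Z); apply/subset_leq_card/subsetP => i.
    by rewrite inE mem_Z.
  by rewrite leq_subLR -[X in (X <= _)%N]cardS addnC leq_add2r (leq_trans le_Z).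
by rewrite /cs size_cat size_map leq_sub2l // leq_add2r.
Qed.

End LowerBound.

(** * Isomorphism invariance and the lower bound for the two extremal families *)

Lemma graph_iso_sym_rel (T U : finType) (g : rel T) (h : rel U) :
  graph_iso g h -> symmetric g -> symmetric h.
Proof.
case=> f [[f' fK f'K] gh] gsym x y.
by rewrite -[x]f'K -[y]f'K -!gh gsym.
Qed.

Lemma graph_iso_irr_rel (T U : finType) (g : rel T) (h : rel U) :
  graph_iso g h -> irreflexive g -> irreflexive h.
Proof. by case=> f [[f' fK f'K] gh] girr x; rewrite -[x]f'K -gh girr. Qed.

(** A permutation similarity preserves the characteristic polynomial, and [lap_eigs] depends on that
    polynomial alone, so the two lists are equal and not merely permutations of each other. *)
Lemma lap_eigs_iso n (g h : rel 'I_n) :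
  graph_iso g h -> lap_eigs g = lap_eigs h.
Proof.
case=> f [f_bij gh]; rewrite /lap_eigs; congr (sval (closed_field_poly_normal _)).
pose s := perm (bij_inj f_bij).
have degE x : vdeg g x = vdeg h (f x).
  rewrite /vdeg -[RHS](on_card_preimset (f := f)); last exact: onW_bij.
  by apply: eq_card => y; rewrite !inE gh.
have LE : laplacian g = row_perm s (col_perm s (laplacian h)).
  apply/matrixP=> i j; rewrite !mxE !permE (inj_eq (bij_inj f_bij)) degE gh.
  by [].
have charE : char_poly_mx (laplacian g)
   = row_perm s (col_perm s (char_poly_mx (laplacian h))).
  by rewrite LE; apply/matrixP=> i j; rewrite !mxE (inj_eq perm_inj).
rewrite /char_poly charE row_permE col_permE !det_mulmx !det_perm.
rewrite mulrCA odd_permV -signr_addb addbb mulr1 //.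
Qed.

Lemma G_ndt_count_ge n d t (h := G_ndt n d t) :
  symmetric h -> irreflexive h -> (2 <= t <= d)%N -> (d < n)%N ->
  (n - d <= lap_count_cc h (n%:R - d%:R + 2%:R)%R n%:R)%N.
Proof.
move=> hsym hirr /andP[t2 td] dn.
(* Off [L] remain the clique and the window with indices [t - 2], [t - 1], [t]: a complete graph on
   [n - d + 2] vertices minus the edge between the window ends. The one extra constraint equates the
   values at these ends. *)
pose L := iota 0 (t - 2) ++ iota t.+1 (d - t).
have sizeL : size L = (d - 2)%N by rewrite size_cat !size_iota; lia.
have lt0 : (t - 2 < n)%N by lia.
have lt1 : (t < n)%N by lia.
have -> : n%:R - d%:R + 2%:R = (n - size L + 0)%:R :> algC.
  rewrite sizeL -natrB; last by lia.
  by rewrite -natrD; congr _%:R; lia.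
have := @lap_count_clique_ge n h hsym hirr L 0
  [:: delta_mx (Ordinal lt0) 0 - delta_mx (Ordinal lt1) 0].
rewrite sizeL /= (_ : (d - 2 + 2 = d)%N); last by lia.
apply=> // u u_ex i j; rewrite !inE !mem_cat !mem_iota => iL jL ij.
have eq_u : u 0 (Ordinal lt0) = u 0 (Ordinal lt1).
  have := u_ex _ (mem_head _ _).
  by rewrite mulmx_deltaB => /subr0_eq.
have vij : (i != j :> nat)%N by [].
have [/andP[i0 j1]|] := boolP ((i == t - 2 :> nat) && (j == t :> nat))%N.
  right; rewrite (_ : i = Ordinal lt0) 1?(_ : j = Ordinal lt1) ?eq_u //.
  - exact/val_inj/eqP.
  - exact/val_inj/eqP.
have [/andP[j0 i1] _|nji nij] := boolP ((j == t - 2 :> nat) && (i == t :> nat))%N.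
  right; rewrite (_ : j = Ordinal lt0) 1?(_ : i = Ordinal lt1) ?eq_u //.
  - exact/val_inj/eqP.
  - exact/val_inj/eqP.
left; rewrite /h /G_ndt; move: vij iL jL nij nji (ltn_ord i) (ltn_ord j).
rewrite /=; case: (leqP i d); case: (leqP j d) => /=; lia.
Qed.

Lemma G_ndra_count_ge n d r a (h := G_ndra n d r a) :
  symmetric h -> irreflexive h -> (2 <= r < d)%N -> (d < n)%N ->
  (n - d <= lap_count_cc h (n%:R - d%:R + 2%:R)%R n%:R)%N.
Proof.
move=> hsym hirr /andP[r2 rd] dn.
(* Off [L] remain the clique and the indices [r - 1] and [r], a complete graph on [n - d + 1]
   vertices. Each of its vertices has a neighbour in [L], at index [r - 2] or [r + 1], whence
   [m = 1]. *)
pose L := iota 0 r.-1 ++ iota r.+1 (d - r).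
have sizeL : size L = (d - 1)%N by rewrite size_cat !size_iota; lia.
have lt0 : (r - 2 < n)%N by lia.
have lt1 : (r.+1 < n)%N by lia.
have -> : n%:R - d%:R + 2%:R = (n - size L + 1)%:R :> algC.
  rewrite sizeL -natrB; last by lia.
  by rewrite -natrD; congr _%:R; lia.
have := @lap_count_clique_ge n h hsym hirr L 1 [::].
rewrite sizeL /= (_ : (d - 1 + 1 = d)%N); last by lia.
apply=> [u _ i j|i]; rewrite !inE !mem_cat !mem_iota.
  move=> iL jL ij; have vij : (i != j :> nat)%N by [].
  left; rewrite /h /G_ndra; move: vij iL jL (ltn_ord i) (ltn_ord j).
  rewrite /=; case: (leqP i d); case: (leqP j d) => /=; lia.
move=> iL.
suff [j jL hij] : exists2 j : 'I_n,
    ((j == r - 2 :> nat) || (j == r.+1 :> nat))%N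
    & h i j.
  rewrite (bigD1 j) /= ?hij // !inE !mem_cat !mem_iota; lia.
have [id|di] := leqP i d.
  have /orP[/eqP ir|/eqP ir] : (i == r.-1 :> nat) || (i == r :> nat) by lia.
    exists (Ordinal lt0); first by rewrite /= eqxx.
    by rewrite /h /G_ndra /= (_ : (r - 2 <= d)%N) ?id /=; lia.
  exists (Ordinal lt1); first by rewrite /= eqxx orbT.
  by rewrite /h /G_ndra /= rd id /= ir eqxx.
have [ia|ai] := ltnP i (d.+1 + a).
  exists (Ordinal lt0); first by rewrite /= eqxx.
  rewrite /h /G_ndra /= leqNgt di /= (_ : (d < r - 2)%N = false); last by lia.
  by rewrite (minn_idPr _) ?(maxn_idPl _) ?ia ?andbT; lia.
exists (Ordinal lt1); first by rewrite /= eqxx orbT.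
rewrite /h /G_ndra /= leqNgt di /= (_ : (d < r.+1)%N = false); last by lia.
by rewrite (minn_idPr _) ?(maxn_idPl _) ?ai ?andbT; lia.
Qed.

(** * Induced paths and recognition of the extremal graphs *)

Local Open Scope nat_scope.

(** The path is a total function on [nat]; its values beyond [d] are arbitrary. *)
Definition induced_path n (g : rel 'I_n) (d : nat) (p : nat -> 'I_n) : Prop :=
  (forall a b, a <= d -> b <= d -> p a = p b -> a = b) /\
  (forall a b, a <= d -> b <= d ->
     g (p a) (p b) = (a.+1 == b) || (b.+1 == a)).

Lemma last_take_nth (T : Type) (x : T) (s : seq T) a :
  a <= size s -> last x (take a s) = nth x (x :: s) a.
Proof.
move=> a_s; rewrite -nth_last size_takel //; case: a a_s => [|a] a_s /=.
  by rewrite take0.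
by rewrite nth_take // (set_nth_default x).
Qed.

(* A shortcut between two vertices of the path would yield a walk of length
   less than [d] between its end points. *)
Lemma diametral_path n (g : rel 'I_n) d :
  symmetric g -> irreflexive g -> 0 < d -> diameter g d ->
  exists2 p, induced_path g d p
    & forall z a b, a <= d -> b <= d -> g z (p a) -> g z (p b) -> b <= a.+2.
Proof.
move=> gsym girr d_gt0 [all_within [d0|[x [y not_within]]]]; first by lia.
have [q [pq lq sq]] := all_within x y.
have size_q : size q = d.
  apply/eqP; rewrite eqn_leq sq leqNgt; apply/negP => lt_q; apply: not_within.
  by exists q; split=> //; lia.
pose p a := nth x (x :: q) a.
have no_shortcut a b r : a <= d -> b <= d ->
    path g (p a) r -> last (p a) r = p b -> b <= a + size r.
  move=> ad bd pr lr; rewrite leqNgt; apply/negP => lt_b; apply: not_within.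
  have pa : last x (take a q) = p a by rewrite last_take_nth ?size_q.
  have pb : last x (take b q) = p b by rewrite last_take_nth ?size_q.
  have : path g x (take b q ++ drop b q) by rewrite cat_take_drop.
  rewrite cat_path pb => /andP[_ path_b].
  exists (take a q ++ r ++ drop b q); split.
  - by rewrite !cat_path take_path //= pa pr lr.
  - by rewrite !last_cat pa lr -pb -last_cat cat_take_drop.
  - by rewrite !size_cat size_drop size_takel ?size_q; lia.
have p_step a : a < d -> g (p a) (p a.+1).
  by move=> ad; have /pathP := pq; apply; rewrite size_q.
exists p; first split.
- move=> a b ad bd pab.
  have := no_shortcut a b [::] ad bd isT pab.
  by have := no_shortcut b a [::] bd ad isT (esym pab) => /=; lia.
- move=> a b ad bd; apply/idP/idP => [gab|/orP[]/eqP eab]; last 2 first.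
  + by rewrite -eab; apply: p_step; lia.
  + by rewrite gsym -eab; apply: p_step; lia.
  have ne : a <> b by move=> ab; rewrite ab girr in gab.
  have := no_shortcut a b [:: p b] ad bd.
  rewrite /= gab => /(_ isT erefl) le_b.
  have := no_shortcut b a [:: p a] bd ad.
  by rewrite /= gsym gab => /(_ isT erefl); lia.
move=> z a b ad bd gza gzb.
have := no_shortcut a b [:: z; p b] ad bd.
by rewrite /= gsym gza gzb => /(_ isT erefl); lia.
Qed.

Section Outside.

Variables (n : nat) (g : rel 'I_n) (d : nat).

Definition outside (p : nat -> 'I_n) : seq 'I_n :=
  [seq z <- index_enum 'I_n | z \notin [seq p a | a <- index_iota 0 d.+1]].

Lemma mem_pathP (p : nat -> 'I_n) z :
  reflect (exists2 a, a <= d & z = p a)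
    (z \in [seq p a | a <- index_iota 0 d.+1]).
Proof.
apply: (iffP mapP) => -[a ad zE]; exists a => //.
  by move: ad; rewrite mem_index_iota.
by rewrite mem_index_iota.
Qed.

Lemma uniq_path (p : nat -> 'I_n) :
  induced_path g d p -> uniq [seq p a | a <- index_iota 0 d.+1].
Proof.
case=> p_inj _; rewrite map_inj_in_uniq ?iota_uniq // => a b.
by rewrite !mem_index_iota; apply: p_inj.
Qed.

Lemma perm_path_outside (p : nat -> 'I_n) : induced_path g d p ->
  perm_eq (index_enum 'I_n)
    ([seq p a | a <- index_iota 0 d.+1] ++ outside p).
Proof.
move=> ip; apply: uniq_perm; first exact: index_enum_uniq.
  rewrite cat_uniq uniq_path // filter_uniq ?index_enum_uniq // andbT.
  by apply/hasPn => z; rewrite mem_filter => /andP[].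
move=> z; rewrite mem_index_enum mem_cat mem_filter mem_index_enum andbT.
by rewrite orbN.
Qed.

Lemma size_index_enum : size (index_enum 'I_n) = n.
Proof. by rewrite [index_enum _]unlock -enumT -cardT card_ord. Qed.

Lemma size_outside (p : nat -> 'I_n) :
  induced_path g d p -> n = d.+1 + size (outside p).
Proof.
move=> /perm_path_outside/perm_size.
rewrite size_cat size_map size_iota subn0 => <-.
by rewrite size_index_enum.
Qed.

(** The isomorphism sends each vertex to its position in the enumeration [s]. *)
Lemma graph_iso_of_seq (h : rel 'I_n) (s : seq 'I_n) (x0 : 'I_n) :
  perm_eq (index_enum 'I_n) s ->
  (forall i j : 'I_n, g (nth x0 s i) (nth x0 s j) = h i j) -> graph_iso g h.
Proof.
move=> perm_s gh.
have size_s : size s = n.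
  by rewrite -(perm_size perm_s) size_index_enum.
have uniq_s : uniq s by rewrite -(perm_uniq perm_s) index_enum_uniq.
have mem_s z : z \in s by rewrite -(perm_mem perm_s) mem_index_enum.
have lt_index z : index z s < n by rewrite -[X in _ < X]size_s index_mem.
exists (fun z => Ordinal (lt_index z)); split.
  exists (fun i : 'I_n => nth x0 s i) => [z|i] /=; first by rewrite nth_index.
  by apply: val_inj; rewrite /= index_uniq // size_s.
by move=> x y; rewrite -gh /= !nth_index.
Qed.

End Outside.

Section Recognition.

Variables (n : nat) (g : rel 'I_n) (d : nat).
Hypothesis gsym : symmetric g.
Hypothesis girr : irreflexive g.

Definition on_path (p : nat -> 'I_n) : pred 'I_n :=
  mem [seq p a | a <- index_iota 0 d.+1].

Definition full_window (p : nat -> 'I_n) (w : 'I_n) (s : nat) : Prop :=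
  s.+2 <= d /\ forall a, a <= d -> g w (p a) = (s <= a <= s.+2).

Definition reverse (p : nat -> 'I_n) (a : nat) : 'I_n := p (d - a).

Lemma induced_path_reverse p :
  induced_path g d p -> induced_path g d (reverse p).
Proof.
case=> p_inj p_adj; split=> [a b ad bd /p_inj|a b ad bd].
  by move=> /(_ (leq_subr _ _) (leq_subr _ _)); lia.
by rewrite /reverse p_adj ?leq_subr //; lia.
Qed.

Lemma on_path_reverse p z : on_path (reverse p) z = on_path p z.
Proof.
apply/mem_pathP/mem_pathP => -[a ad ->]; exists (d - a); rewrite ?leq_subr //.
by rewrite /reverse subKn.
Qed.

Lemma full_window_reverse p w s :
  full_window p w s -> full_window (reverse p) w (d - s.+2).
Proof.
case=> sd win; split; first by lia.
by move=> a ad; rewrite /reverse win ?leq_subr //; lia.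
Qed.

(** Listing the path first and [O] after it reproduces the vertex numbering of [G_ndt] and [G_ndra];
    the order chosen for [O] decides which vertices come first in the clique. *)
Lemma graph_iso_path_clique (h : rel 'I_n) p (O : seq 'I_n) :
  induced_path g d p ->
  perm_eq (index_enum 'I_n) ([seq p a | a <- index_iota 0 d.+1] ++ O) ->
  {in O &, forall z z', z != z' -> g z z'} ->
  (forall i j : 'I_n, i <= d -> j <= d -> h i j = (i.+1 == j) || (j.+1 == i)) ->
  (forall i j : 'I_n, d < i -> d < j -> h i j = (i != j :> nat)) ->
  (forall i j : 'I_n, i <= d -> d < j ->
     h i j = h j i /\ h i j = g (nth (p 0) O (j - d.+1)) (p i)) ->
  graph_iso g h.
Proof.
case=> _ p_adj perm_O clique h_path h_clique h_mixed.
set P := [seq p a | a <- index_iota 0 d.+1] in perm_O.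
have size_P : size P = d.+1 by rewrite size_map size_iota subn0.
have size_O : d.+1 + size O = n.
  by rewrite -size_P -size_cat -(perm_size perm_O) size_index_enum.
have uniq_O : uniq O.
  have : uniq (P ++ O) by rewrite -(perm_uniq perm_O) index_enum_uniq.
  by rewrite cat_uniq => /and3P[].
apply: (graph_iso_of_seq (x0 := p 0) perm_O) => i j; rewrite !nth_cat size_P.
have nth_P (k : 'I_n) : k <= d -> nth (p 0) P k = p k.
  move=> kd; rewrite (nth_map 0) ?nth_iota ?size_iota ?subn0 ?add0n //.
have [id|di] := leqP i d; have [jd|dj] := leqP j d; rewrite ?ltnS ?id ?jd.
- by rewrite !nth_P // h_path // p_adj.
- by rewrite leqNgt dj /= nth_P // (h_mixed i j id dj).2 gsym.
- by rewrite leqNgt di /= nth_P // -(h_mixed j i jd di).1 (h_mixed j i jd di).2.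
rewrite (leqNgt i) (leqNgt j) di dj /= h_clique //; have [ij|ij] := eqVneq (i : nat) j.
  by rewrite ij girr.
have lt_O (k : 'I_n) : d < k -> k - d.+1 < size O.
  by move=> dk; rewrite ltn_subLR // size_O.
by rewrite clique ?mem_nth ?nth_uniq ?lt_O //; lia.
Qed.

Lemma graph_iso_ndt p s : induced_path g d p ->
  {in predC (on_path p) &, forall z z', z != z' -> g z z'} ->
  (forall w, ~~ on_path p w -> full_window p w s) ->
  graph_iso g (G_ndt n d s.+2).
Proof.
move=> ip clique win; have sizeO := size_outside ip.
have memO z : z \in outside d p -> ~~ on_path p z.
  by rewrite mem_filter => /andP[].
apply: (graph_iso_path_clique ip (perm_path_outside ip)).
- by move=> z z' /memO zO /memO z'O; apply: clique.
- by move=> i j id jd; rewrite /G_ndt /= id jd.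
- by move=> i j di dj; rewrite /G_ndt /= leqNgt di dj.
move=> i j id dj; have lt_j := ltn_ord j; rewrite /G_ndt /= id dj.
rewrite (leqNgt j) dj (ltnNge d i) id /= minnC (minn_idPr _); last by lia.
split=> //; have [|_ ->] // := win (nth (p 0) (outside d p) (j - d.+1)).
  by apply/memO/mem_nth; rewrite ltn_subLR // -sizeO.
by rewrite subSS subSS subn0.
Qed.

(** The vertices adjacent to [p s], those with the left window, are listed first and become the [a]
    vertices joined to [v_{r-1}]. Path indices start at 0, so [r = s.+2] gives [v_{r-1}] the index
    [s]. *)
Lemma graph_iso_ndra p s : induced_path g d p ->
  {in predC (on_path p) &, forall z z', z != z' -> g z z'} ->
  (forall w, ~~ on_path p w ->
     full_window p w s \/ full_window p w s.+1) ->
  graph_iso g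
    (G_ndra n d s.+2 (size [seq w <- outside d p | g w (p s)])).
Proof.
move=> ip clique win; have sizeO := size_outside ip.
set A := [seq w <- outside d p | g w (p s)].
set B := [seq w <- outside d p | ~~ g w (p s)].
have perm_AB : perm_eq (A ++ B) (outside d p).
  by rewrite perm_filterC.
have size_AB : size A + size B = size (outside d p).
  by rewrite -size_cat (perm_size perm_AB).
have memO z : z \in A ++ B -> ~~ on_path p z.
  by rewrite (perm_mem perm_AB) mem_filter => /andP[].
apply: (graph_iso_path_clique (O := A ++ B) ip).
- rewrite (perm_trans (perm_path_outside ip)) // perm_cat2l perm_sym.
  exact: perm_AB.
- by move=> z z' /memO zO /memO z'O; apply: clique.
- by move=> i j id jd; rewrite /G_ndra /= id jd.
- by move=> i j di dj; rewrite /G_ndra /= leqNgt di dj.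
move=> i j id dj; have lt_j := ltn_ord j; rewrite /G_ndra /= id dj.
rewrite (leqNgt j) dj (ltnNge d i) id /= minnC maxnC (minn_idPr _); last by lia.
rewrite (maxn_idPl _); last by lia.
split=> //.
set w := nth _ _ _.
have wO : ~~ on_path p w 
  by apply/memO/mem_nth; rewrite size_cat size_AB ltn_subLR // -sizeO.
have gws : g w (p s) = (j < d.+1 + size A).
  rewrite /w nth_cat; case: ifP => [lt_A|ge_A].
    have : nth (p 0) A (j - d.+1) \in A by apply: mem_nth.
    by rewrite mem_filter => /andP[-> _]; lia.
  have : nth (p 0) B (j - d.+1 - size A) \in B.
    apply: mem_nth; rewrite ltn_subLR; last by lia.
    by rewrite size_AB ltn_subLR // -sizeO.
  by rewrite mem_filter => /andP[/negPf-> _]; lia.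
case: (win w wO) => [] [sd full]; rewrite full //.
  by rewrite full in gws; lia.
by rewrite full in gws; lia.
Qed.

End Recognition.

(** * The upper bound and the case of equality *)

Section Extremal.

Variables (n : nat) (g : rel 'I_n) (d : nat).
Hypothesis gsym : symmetric g.
Hypothesis girr : irreflexive g.

Lemma graph_iso_path p : induced_path g d p -> outside d p = [::] ->
  graph_iso g (path_graph d.+1).
Proof.
move=> ip out0; have [p_inj p_adj] := ip.
have f_bij : bijective (fun i : 'I_d.+1 => p i).
  apply: inj_card_bij => [i j /p_inj eq_ij|].
    by apply/val_inj/eq_ij; rewrite -ltnS.
  by rewrite !card_ord (size_outside ip) out0 addn0.
have [f fK Kf] := f_bij; exists f; split; first by exists (fun i : 'I_d.+1 => p i).
by move=> x y; rewrite -{1}[x]Kf -{1}[y]Kf p_adj // -ltnS.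
Qed.

Lemma in_window_exists p w : 2 <= d ->
  (forall z a b, a <= d -> b <= d -> g z (p a) -> g z (p b) -> b <= a.+2) ->
  exists s, in_window g d p w s.
Proof.
move=> d2 near; pose Q := fun a => (a <= d) && g w (p a).
have [exQ|noQ] := boolP (has Q (iota 0 d.+1)); last first.
  exists 0; split=> // a ad gwa; move/hasPn: noQ => /(_ a).
  by rewrite mem_iota /Q ad gwa => /(_ ad).
have {}exQ : exists a, Q a by case/hasP: exQ => a _ Qa; exists a.
case: (ex_minnP exQ) => a0 /andP[a0d gwa0] min_a0.
(* The window starts at the first path neighbour of [w], moved left if necessary so that three
   vertices still fit on the path. *)
exists (minn a0 (d - 2)); split; first by lia.
move=> b bd gwb; have := near w a0 b a0d bd gwa0 gwb.
by have := min_a0 b; rewrite /Q bd gwb => /(_ isT); lia.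
Qed.

(** Here [k] vertices off the path stay free and [m] are forced to zero, so the constant left for
    the path inequalities is 4 for one free vertex and 5 for two. *)
Lemma thresholdE k m : n = d.+1 + k + m ->
  (n%:R - d%:R + 2%:R = (m + k.+3)%:R :> algC)%R.
Proof.
move=> nE; rewrite -natrB; last by lia.
by rewrite -natrD; congr (_%:R)%R; lia.
Qed.

Lemma perm_outside1 p w : induced_path g d p -> w \in outside d p ->
  perm_eq (index_enum 'I_n)
    ([seq p a | a <- index_iota 0 d.+1] ++ [:: w] ++ rem w (outside d p)).
Proof.
move=> ip wO; rewrite (perm_trans (perm_path_outside ip)) // perm_cat2l.
exact: perm_to_rem.
Qed.

Lemma perm_outside2 p w w' : induced_path g d p -> w \in outside d p ->
  w' \in outside d p -> w != w' ->
  perm_eq (index_enum 'I_n)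
    ([seq p a | a <- index_iota 0 d.+1] ++ [:: w; w']
     ++ rem w' (rem w (outside d p))).
Proof.
move=> ip wO w'O ww'; rewrite (perm_trans (perm_outside1 ip wO)) //.
rewrite perm_cat2l /= perm_cons perm_to_rem // mem_rem_uniq ?inE ?w'O 1?eq_sym.
  by rewrite ww'.
exact/filter_uniq/index_enum_uniq.
Qed.

Lemma order_outside p (ws R : seq 'I_n) :
  perm_eq (index_enum 'I_n)
    ([seq p a | a <- index_iota 0 d.+1] ++ ws ++ R) ->
  n = d.+1 + size ws + size R.
Proof.
move/perm_size; rewrite size_index_enum !size_cat size_map size_iota subn0.
by rewrite addnA.
Qed.

Lemma subn_diam k m : n = d.+1 + k + m -> n - d = m + k.+1.
Proof. by lia. Qed.

Local Notation thr := (n%:R - d%:R + 2%:R)%R.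

Lemma lap_count_upper p w s b : induced_path g d p -> w \in outside d p ->
  in_window g d p w s -> lap_count_cc g thr b <= n - d.
Proof.
move=> ip wO win; have perm_w := perm_outside1 ip wO.
have nE := order_outside perm_w; have [_ p_adj] := ip.
rewrite (thresholdE nE) (subn_diam nE).
exact: outside_vertex_le perm_w win.
Qed.

Lemma extremal_full_window p w s b : induced_path g d p ->
  w \in outside d p -> in_window g d p w s ->
  lap_count_cc g thr b = n - d -> full_window g d p w s.
Proof.
move=> ip wO win count_eq; have [sd inw] := win.
have perm_w := perm_outside1 ip wO; have nE := order_outside perm_w.
have [/and3P[g0 g1 g2]|missing] :=
    boolP [&& g w (p s), g w (p s.+1) & g w (p s.+2)].
  split=> // a ad; apply/idP/idP => [/(inw a ad)//|a_in].
  have : [|| a == s, a == s.+1 | a == s.+2] by lia.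
  by case/or3P=> /eqP->.
have [_ p_adj] := ip.
have := missing_neighbour_le gsym girr p_adj erefl b perm_w win missing.
by rewrite -(thresholdE nE) count_eq (subn_diam nE) leq_add2l.
Qed.

Lemma extremal_pair p w w' s s' b : induced_path g d p ->
  w \in outside d p -> w' \in outside d p -> w != w' ->
  in_window g d p w s -> in_window g d p w' s' -> s <= s' ->
  lap_count_cc g thr b = n - d -> g w w' /\ s' <= s.+1.
Proof.
move=> ip wO w'O ww' win win' ss' count_eq.
have perm_w := perm_outside2 ip wO w'O ww'; have nE := order_outside perm_w.
have [_ p_adj] := ip; apply/andP; apply: contraT; rewrite negb_and -ltnNge.
move/(pair_le gsym girr p_adj erefl b perm_w win win' ss').
by rewrite -(thresholdE nE) count_eq (subn_diam nE) leq_add2l.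
Qed.

(** The witnesses [w] and [w'] ensure that each of the two windows occurs, which gives both bounds
    on [a]. *)
Lemma graph_iso_two_windows p s w w' : induced_path g d p ->
  {in predC (on_path d p) &, forall z z', z != z' -> g z z'} ->
  (forall z, ~~ on_path d p z ->
     full_window g d p z s \/ full_window g d p z s.+1) ->
  ~~ on_path d p w -> full_window g d p w s ->
  ~~ on_path d p w' -> full_window g d p w' s.+1 ->
  exists2 a, 1 <= a <= n - d - 2 & graph_iso g (G_ndra n d s.+2 a).
Proof.
move=> ip clique win wP full wP' full'.
exists (size [seq z <- outside d p | g z (p s)]); last exact: graph_iso_ndra.
have [[sd fullE] [s'd fullE']] := (full, full').
rewrite size_filter -has_count; apply/andP; split.
  apply/hasP; exists w; first by rewrite mem_filter wP mem_index_enum.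
  by rewrite fullE; lia.
have : 0 < count (predC (fun z => g z (p s))) (outside d p).
  rewrite -has_count; apply/hasP; exists w'.
    by rewrite mem_filter wP' mem_index_enum.
  by rewrite /= fullE'; lia.
have := count_predC (fun z => g z (p s)) (outside d p).
by have := size_outside ip; lia.
Qed.

End Extremal.

Lemma extremal_graphs n (g : rel 'I_n) d p (b : algC) :
  symmetric g -> irreflexive g -> 2 <= d -> induced_path g d p ->
  (forall z a b, a <= d -> b <= d -> g z (p a) -> g z (p b) -> b <= a.+2) ->
  outside d p != [::] ->
  lap_count_cc g (n%:R - d%:R + 2%:R)%R b = n - d ->
  (exists t, 2 <= t <= d./2 + 1 /\ graph_iso g (G_ndt n d t)) \/
  (exists r a, [/\ 2 <= r <= d.+1./2, 1 <= a <= n - d - 2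
                 & graph_iso g (G_ndra n d r a)]).
Proof.
move=> gsym girr d2 ip near out0 count_eq.
have memO z : (z \in outside d p) = ~~ on_path d p z.
  by rewrite mem_filter mem_index_enum andbT.
have full_in z s : full_window g d p z s -> in_window g d p z s.
  by case=> sd winE; split=> // a ad; rewrite winE.
have full z : ~~ on_path d p z -> exists s, full_window g d p z s.
  rewrite -memO => zO; have [s win] := in_window_exists z d2 near.
  by exists s; apply: extremal_full_window zO win count_eq.
have pair z z' s s' : ~~ on_path d p z -> ~~ on_path d p z' -> z != z' ->
    full_window g d p z s -> full_window g d p z' s' -> s <= s' ->
    g z z' /\ s' <= s.+1.
  rewrite -!memO => zO z'O zz' /full_in win /full_in win' ss'.
  exact: extremal_pair ip zO z'O zz' win win' ss' count_eq.
have clique : {in predC (on_path d p) &, forall z z', z != z' -> g z z'}.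
  move=> z z' zP z'P zz'; have [s win] := full z zP; have [s' win'] := full z' z'P.
  have [ss'|/ltnW s's] := leqP s s'; first by have [] := pair z z' s s'.
  by rewrite gsym; have [] := pair z' z s' s; rewrite // eq_sym.
have exQ : exists s, has (fun z => g z (p s)) (outside d p).
  case E: (outside d p) out0 => [//|z O] _; have zP : ~~ on_path d p z.
    by rewrite -memO E mem_head.
  have [s [sd winE]] := full z zP; exists s => /=.
  by rewrite winE ?leqnn //; lia.
(* The leftmost path vertex with a neighbour off the path is where the leftmost window starts; by
   [pair] every other window starts there or one step later. *)
case: (ex_minnP exQ) => s /hasP[w wO gws] min_s.
have wP : ~~ on_path d p w by rewrite -memO.
have le_s z s' : ~~ on_path d p z -> full_window g d p z s' -> s <= s'.
  move=> zP [s'd winE]; apply/min_s/hasP; exists z; first by rewrite memO.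
  by rewrite winE; lia.
have sd' : s <= d.
  have [s' [s'd winE]] := full w wP.
  by apply: leq_trans (le_s w s' wP _) _ => //; lia.
have full_w : full_window g d p w s.
  have [s' win] := full w wP; have [s'd winE] := win.
  have ss' := le_s w s' wP win; rewrite winE // in gws.
  by have -> : s = s' by lia.
have two_windows z : ~~ on_path d p z ->
    full_window g d p z s \/ full_window g d p z s.+1.
  move=> zP; have [s' win] := full z zP; have ss' := le_s z s' zP win.
  have [zw|zw] := eqVneq w z; first by left; rewrite -zw.
  have [_ s's] := pair w z s s' wP zP zw full_w win ss'.
  have : (s' == s) || (s' == s.+1) by lia.
  by case/orP=> /eqP <-; [left|right].
have ip' := induced_path_reverse ip.
have clique' : {in predC (on_path d (reverse d p)) &,
    forall z z', z != z' -> g z z'}.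
  move=> z z'; rewrite !inE !on_path_reverse => zP z'P.
  exact: clique.
have [sd _] := full_w.
have [all_s|] := boolP (all (fun z => g z (p s)) (outside d p)).
  left; have all_full z : ~~ on_path d p z -> full_window g d p z s.
    move=> zP; have [//|[s'd winE]] := two_windows z zP.
    have := allP all_s z; rewrite memO => /(_ zP); rewrite winE //.
    by rewrite ltnn.
  have [le_t|gt_t] := leqP s.+2 (d./2 + 1).
    by exists s.+2; split; [lia | apply: graph_iso_ndt all_full].
  (* Reversing the path replaces [t] by [d + 2 - t], which brings it into the required range. *)
  exists (d - s.+2).+2; split; first by lia.
  apply: (graph_iso_ndt gsym girr ip' clique') => z.
  by rewrite on_path_reverse => /all_full/full_window_reverse.
case/allPn=> w'; rewrite memO => w'P ngw's.
have full_w' : full_window g d p w' s.+1.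
  have [[_ winE]|//] := two_windows w' w'P.
  by rewrite winE ?leqnn ?leqW in ngw's.
right; have [s'd _] := full_w'.
have [le_r|gt_r] := leqP s.+2 d.+1./2.
  have [a a_bounds iso] :=
    graph_iso_two_windows gsym girr ip clique two_windows wP full_w w'P full_w'.
  by exists s.+2, a; split=> //; lia.
(* Reversing the path replaces [r] by [d + 1 - r] and exchanges the two windows, hence also the
   roles of [w] and [w']. *)
have [|||||a a_bounds iso] := @graph_iso_two_windows n g d gsym girr
    (reverse d p) (d - s.+3) w' w ip' clique'.
- move=> z; rewrite on_path_reverse => /two_windows[]/full_window_reverse win.
    by right; have -> : (d - s.+3).+1 = d - s.+2 by lia.
  by left.
- by rewrite on_path_reverse.
- exact: full_window_reverse.
- by rewrite on_path_reverse.
- have := full_window_reverse full_w.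
  by have -> : d - s.+2 = (d - s.+3).+1 by lia.
by exists (d - s.+3).+2, a; split=> //; lia.
Qed.

Theorem theorem1p2 (n : nat) (g : rel 'I_n) (d : nat)
  (gsym : symmetric g) (girr : irreflexive g)
  (gconn : connected_graph g) (gdiam : diameter g d) (d_ge2 : 2 <= d)
  (not_path : ~ graph_iso g (path_graph d.+1)) :
  lap_count_cc g (n%:R - d%:R + 2%:R)%R (n%:R)%R <= n - d /\
  (lap_count_cc g (n%:R - d%:R + 2%:R)%R (n%:R)%R = n - d <->
     (exists t, 2 <= t <= d./2 + 1 /\ graph_iso g (G_ndt n d t)) \/
     (exists r a, [/\ 2 <= r <= d.+1./2, 1 <= a <= n - d - 2
                    & graph_iso g (G_ndra n d r a)])).
Proof.
have [p ip near] := diametral_path gsym girr (ltnW d_ge2) gdiam.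
have out0 : outside d p != [::].
  by apply/eqP => out0; apply: not_path; apply: graph_iso_path ip out0.
have dn : d < n by rewrite (size_outside ip) leq_addr.
have upper : lap_count_cc g (n%:R - d%:R + 2%:R)%R n%:R%R <= n - d.
  case E: (outside d p) out0 => [//|w O] _.
  have wO : w \in outside d p by rewrite E mem_head.
  have [s win] := in_window_exists w d_ge2 near.
  exact: lap_count_upper wO win.
split=> //; split; first exact: extremal_graphs near out0.
(* Given the upper bound, only the lower bound remains; it is proved on the model graph and
   transported, since isomorphic graphs have the same list of eigenvalues. *)
move=> extremal; apply/eqP; rewrite eqn_leq upper /=.
case: extremal => [[t [t_bounds iso]]|[r [a [r_bounds a_bounds iso]]]].
  rewrite /lap_count_cc (lap_eigs_iso iso); apply: G_ndt_count_ge => //.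
  - exact: graph_iso_sym_rel iso gsym.
  - exact: graph_iso_irr_rel iso girr.
  - by lia.
rewrite /lap_count_cc (lap_eigs_iso iso); apply: G_ndra_count_ge => //.
- exact: graph_iso_sym_rel iso gsym.
- exact: graph_iso_irr_rel iso girr.
- by lia.
Qed.
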